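(* Let $X$ be a smooth connected variety over $\mathbb{C}$, $L$ a line bundle on $X$, $n\geq 2$ an integer, and $X_n$ the trivial primitive multiple scheme of multiplicity $n$ with support $X$ and associated line bundle $L$. Consider the action of $\mathrm{Aut}(X_n)$ on $H^1(X,(\Omega_{X_2|X})^*\otimes L^n)\simeq H^1(X,L^{n-1})\times H^1(X,T_X\otimes L^n)$ whose orbits parametrize the extensions of $X_n$ to primitive multiple schemes of multiplicity $n+1$, and the subgroup $\mathbb{C}^*\subset\mathrm{Aut}(X_n)$. For every $(\eta,\epsilon)\in H^1(X,L^{n-1})\times H^1(X,T_X\otimes L^n)$ and $\lambda\in\mathbb{C}^*$ we have $$\lambda.(\eta,\epsilon)=(\lambda^{n-1}\eta,\lambda^n\epsilon).$$
   Context: Schemes. The trivial scheme $X_n$ is the $n$-th infinitesimal neighbourhood (defined by the $n$-th power of the ideal) of the zero section $X$ in the total space of $L^*$; $X_2\subset X_n$ is the second infinitesimal neighbourhood. $\mathrm{Aut}(X_n)$ is the group of automorphisms of $X_n$ inducing the identity on $X$. For $\lambda\in\mathbb{C}^*$, multiplication by $\lambda$ in $L^*$ induces an automorphism of $X_n$; in this way $\mathbb{C}^*$ is a subgroup of $\mathrm{Aut}(X_n)$. A primitive multiple scheme of multiplicity $m$ with support $X$ is a Cohen-Macaulay scheme with reduced subscheme $X$, locally embeddable in smooth varieties of dimension $\dim(X)+1$, $m$ being the smallest integer with $\mathcal{I}_X^m=0$; it is locally isomorphic to $U\times\mathrm{Spec}(\mathbb{C}[t]/(t^m))$. Group sheaf.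 For an open $U\subset X$, $\mathcal{G}_m(U)$ is the group of automorphisms of the $\mathbb{C}$-algebra $\mathcal{O}_X(U)[t]/(t^m)$ inducing the identity on the quotient by $(t)$; $H^1(X,\mathcal{G}_m)$ is the set of isomorphism classes of primitive multiple schemes of multiplicity $m$ with support $X$. Let $(\nu_{ij})$ be a cocycle defining $L$ for an open cover $(U_i)$. The trivial scheme of multiplicity $n+1$ is given by the cocycle $(g_{ij})$ of $\mathcal{G}_{n+1}$, $g_{ij}:f\mapsto f$ (for $f\in\mathcal{O}_X(U_{ij})$), $t\mapsto\nu_{ij}t$. Parametrization. Since $X_n$ is trivial, $(\Omega_{X_2|X})^*\simeq T_X\oplus L^{-1}$. Let $\eta\in H^1(X,L^{n-1})$, $\epsilon\in H^1(X,T_X\otimes L^n)$ be represented by $(\eta_{ij})$, $(\epsilon_{ij})$, $\eta_{ij}\in\mathcal{O}_X(U_{ij})$, $\epsilon_{ij}\in T_X(U_{ij})$, with $\eta_{ik}=\eta_{ij}+\nu_{ij}^{n-1}\eta_{jk}$ and $\epsilon_{ik}=\epsilon_{ij}+\nu_{ij}^n\epsilon_{jk}$ (using the trivialization of $L$ on $U_i$). Let $\gamma_{ij}\in\mathcal{G}_{n+1}(U_{ij})$ be $f\mapsto f+\epsilon_{ij}(f)t^n$, $t\mapsto(1+\eta_{ij}t^{n-1})t$. Then $(\gamma_{ij}g_{ij})$ is a cocycle of $\mathcal{G}_{n+1}$ defining an extension of $X_n$ to multiplicity $n+1$, and every extension is obtained in this way. Action. Let $\chi\in\mathrm{Aut}(X_n)$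 be given locally by $\chi_i\in\mathcal{G}_n(U_i)$ (the expression of $\chi^*$ in the trivialization over $U_i$; for $\lambda\in\mathbb{C}^*$ it is $f\mapsto f$, $t\mapsto\lambda t$), and let $c_i\in\mathcal{G}_{n+1}(U_i)$ be a lift of $\chi_i$. Then $\chi\cdot(\eta,\epsilon)$ is the class defined by $\theta_{ij}=c_i\gamma_{ij}g_{ij}c_j^{-1}g_{ij}^{-1}$. Two elements define isomorphic extensions if and only if they are in the same orbit of $\mathrm{Aut}(X_n)$. *)

(* Defs.v *)
From HB Require Import structures.
From mathcomp Require Import all_boot all_order all_algebra generic_quotient.
From mathcomp Require Import complex ring.
From mathcomp Require Import boolp classical_sets functions reals topology.
From mathcomp Require mpoly.

Set Implicit Arguments.
Unset Strict Implicit.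
Unset Printing Implicit Defensive.

Import GRing.Theory.
Local Open Scope classical_set_scope.
Local Open Scope ring_scope.
Local Open Scope quotient_scope.

(** * Varieties, as spaces with functions

   Varieties over an algebraically closed field K are taken in the sense of
   Serre and Mumford: a topological space (of closed points) with a sheaf of
   K-valued functions, locally isomorphic to an affine algebraic set.

   Convention used throughout: a function on a subset U is represented by its
   extension by zero outside U, and its restriction to V is [restr V f]. *)

Definition restr (T : Type) (E : nmodType) (V : set T) (f : T -> E) : T -> E :=
  patch (fun=> 0) V f.

(* [reg U] is the K-algebra O(U). It is only meaningful for U open. *)
Record fspace (K : fieldType) := FSpace {
  fs_top :> topologicalType;
  reg : set fs_top -> set (fs_top -> K);
  reg_supp : forall U f x, reg U f -> ~ U x -> f x = 0;
  reg_cst : forall U c, open U -> reg U (restr U (fun=> c));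
  reg_add : forall U f g, open U -> reg U f -> reg U g ->
    reg U (fun x => f x + g x);
  reg_mul : forall U f g, open U -> reg U f -> reg U g ->
    reg U (fun x => f x * g x);
  reg_restr : forall U V f, open U -> open V -> V `<=` U -> reg U f ->
    reg V (restr V f);
  reg_glue : forall U f, open U -> (forall x, ~ U x -> f x = 0) ->
    (forall x, U x ->
       exists V, [/\ open V, V x, V `<=` U & reg V (restr V f)]) ->
    reg U f }.

Section Varieties.
Variable K : fieldType.
Implicit Types X Y : fspace K.

Definition zeros m (S : set (mpoly.mpoly m K)) : set ('I_m -> K) :=
  [set z | forall p, S p -> mpoly.meval z p = 0].

(* phi is an isomorphism of spaces with functions from the open subspace U of X
   onto the algebraic set Z, with the Zariski topology and the functions that
   are locally quotients of polynomials. *)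
Definition chart X (U : set X) m (Z : set ('I_m -> K)) (phi : X -> 'I_m -> K) :=
  [/\ set_bij U Z phi,
      forall W : set X, W `<=` U ->
        open W <-> exists S, phi @` W = Z `\` zeros S
    & forall (W : set X) (f : X -> K), open W -> W `<=` U ->
        (forall x, ~ W x -> f x = 0) ->
        reg W f <-> forall x, W x -> exists p q : mpoly.mpoly m K,
          mpoly.meval (phi x) q != 0 /\
          forall y, W y -> mpoly.meval (phi y) q != 0 ->
            f y = mpoly.meval (phi y) p / mpoly.meval (phi y) q].

Definition prevariety X :=
  compact [set: X] /\
  forall x : X, exists (U : set X) m (S : set (mpoly.mpoly m K)) phi,
    [/\ open U, U x & chart U (zeros S) phi].

Definition regular_map Y X (h : Y -> X) :=
  continuous h /\
  forall (V : set X) f, open V -> reg V f -> reg (h @^-1` V) (f \o h).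

Definition separated X :=
  forall Y (g h : Y -> X), prevariety Y -> regular_map g -> regular_map h ->
    closed [set y | g y = h y].

Definition variety X := prevariety X /\ separated X.

(* Jacobian criterion: near each point, X is the zero locus in an affine space
   of r polynomials with linearly independent differentials at every zero. *)
Definition smooth X :=
  forall x : X, exists (U : set X) m r (f : 'I_r -> mpoly.mpoly m K) phi,
    [/\ open U, U x, chart U (zeros (range f)) phi
      & forall z, zeros (range f) z ->
          \rank (\matrix_(i < r, j < m)
                   mpoly.meval z (mpoly.mderiv j (f i))) = r].

End Varieties.

(** * Sheaves of K-vector spaces and H^1 *)

(* The sections over U form the subspace [sec U] of a fixed vector space, whose
   elements are extended by zero; [res V] induces restriction to V `<=` U. *)
Record sheaf (K : fieldType) (X : topologicalType) := Sheaf {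
  amb : lmodType K;
  sec : set X -> set amb;
  res : set X -> amb -> amb;
  sec0 : forall U, open U -> sec U 0;
  sec_lin : forall U a s t, open U -> sec U s -> sec U t -> sec U (a *: s + t);
  res_lin : forall V a s t, res V (a *: s + t) = a *: res V s + res V t;
  res_res : forall U V s, res V (res U s) = res (U `&` V) s;
  sec_res : forall U V s, open U -> open V -> sec U s -> sec (U `&` V) (res V s)
}.
Arguments sec {K X} F U _ : rename.
Arguments res {K X} F V _ : rename.

Record cover (X : topologicalType) := Cover {
  cidx :> Type;
  cset : cidx -> set X;
  cset_open : forall a, open (cset a);
  cset_cover : forall x, exists a, cset a x }.
Arguments cset {X} V a _ : rename.

Section H1.
Variables (K : fieldType) (X : topologicalType) (F : sheaf K X).

Record cocycle (V : cover X) := Cocycle {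
  cval :> V -> V -> amb F;
  cval_sec : forall a b, sec F (cset V a `&` cset V b) (cval a b);
  cval_cond : forall a b c,
    let Q := cset V a `&` cset V b `&` cset V c in
    res F Q (cval a c) = res F Q (cval a b) + res F Q (cval b c) }.

Definition cocycle1 := {V : cover X & cocycle V}.

(* Equality of classes in the direct limit of the Cech H^1 over all covers. *)
Definition cohomologous (z z' : cocycle1) : Prop :=
  exists (W : cover X) (r : W -> tag z) (r' : W -> tag z') (b : W -> amb F),
  [/\ forall w, cset W w `<=` cset (tag z) (r w),
      forall w, cset W w `<=` cset (tag z') (r' w),
      forall w, sec F (cset W w) (b w)
    & forall v w, let Q := cset W v `&` cset W w in
        res F Q (tagged z (r v) (r w)) =
        res F Q (tagged z' (r' v) (r' w)) + (res F Q (b v) - res F Q (b w))].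

Lemma resD V s t : res F V (s + t) = res F V s + res F V t.
Proof. by have := res_lin V 1 s t; rewrite !scale1r. Qed.

Lemma res0 V : res F V 0 = 0.
Proof. by apply: (addrI (res F V 0)); rewrite -resD !addr0. Qed.

Lemma resZ V a s : res F V (a *: s) = a *: res F V s.
Proof. by have := res_lin V a s 0; rewrite !addr0 res0 addr0. Qed.

Lemma resN V s : res F V (- s) = - res F V s.
Proof. by rewrite -scaleN1r resZ scaleN1r. Qed.

Lemma resB V s t : res F V (s - t) = res F V s - res F V t.
Proof. by rewrite resD resN. Qed.

Lemma secD U s t : open U -> sec F U s -> sec F U t -> sec F U (s + t).
Proof. by move=> oU Us Ut; rewrite -[s]scale1r; exact: sec_lin. Qed.

Lemma secZ U a s : open U -> sec F U s -> sec F U (a *: s).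
Proof. by move=> oU Us; rewrite -[_ *: _]addr0; apply: sec_lin => //; exact: sec0. Qed.

Lemma sec_resS U V s : open U -> open V -> V `<=` U -> sec F U s ->
  sec F V (res F V s).
Proof. by move=> oU oV /setIidr VU Us; have := sec_res oU oV Us; rewrite VU. Qed.

Lemma res_resS U V s : V `<=` U -> res F V (res F U s) = res F V s.
Proof. by move=> VU; rewrite res_res (setIidr VU). Qed.

Lemma cval_condS V (z : cocycle V) a b c Q :
  Q `<=` cset V a -> Q `<=` cset V b -> Q `<=` cset V c ->
  res F Q (z a c) = res F Q (z a b) + res F Q (z b c).
Proof.
move=> Qa Qb Qc; have := cval_cond z a b c => /= /(congr1 (res F Q)).
have QI : Q `<=` cset V a `&` cset V b `&` cset V c.
  by move=> x Qx; split; [split; [exact: Qa|exact: Qb]|exact: Qc].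
by rewrite resD !(res_resS _ QI).
Qed.

Lemma cohomologous_refl z : cohomologous z z.
Proof.
exists (tag z), id, id, (fun=> 0); split=> [w //|w //||].
- by move=> w; apply: sec0; exact: cset_open.
- by move=> v w /=; rewrite subrr addr0.
Qed.

Lemma cohomologous_sym z z' : cohomologous z z' -> cohomologous z' z.
Proof.
move=> [W [r [r' [b [Wr Wr' bs E]]]]].
exists W, r', r, (fun w => - b w); split=> //.
- by move=> w; rewrite -scaleN1r; apply: secZ => //; exact: cset_open.
- by move=> v w /=; rewrite E -addrA !resN -opprD subrr addr0.
Qed.

Program Definition cover_meet (V W : cover X) : cover X :=
  @Cover X (V * W)%type (fun p => cset V p.1 `&` cset W p.2) _ _.
Next Obligation. by move=> V W [v w] /=; apply: openI; exact: cset_open. Qed.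
Next Obligation.
move=> V W x; have [v Vx] := cset_cover V x; have [w Wx] := cset_cover W x.
by exists (v, w).
Qed.

Lemma cohomologous_trans z1 z2 z3 :
  cohomologous z1 z2 -> cohomologous z2 z3 -> cohomologous z1 z3.
Proof.
move=> [W [r1 [r2 [b [Wr1 Wr2 bs E]]]]] [W' [s2 [s3 [c [Ws2 Ws3 cs E']]]]].
pose M := cover_meet W W'.
exists M, (fun p => r1 p.1), (fun p => s3 p.2),
  (fun p => res F (cset M p)
     (b p.1 + c p.2 + res F (cset M p) (tagged z2 (r2 p.1) (s2 p.2)))).
split.
- by move=> p x [/Wr1].
- by move=> p x [_ /Ws3].
- move=> p; have oM := @cset_open _ M p.
  have oW := @cset_open _ W p.1; have oW' := @cset_open _ W' p.2.
  rewrite !resD; apply: secD => //; first apply: secD => //.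
  + by apply: sec_resS (bs _) => // x [].
  + by apply: sec_resS (cs _) => // x [].
  + rewrite res_resS //; apply: sec_resS (cval_sec _ _ _) => //.
      by apply: openI; exact: cset_open.
    by move=> x [/Wr2 ? /Ws2].
- move=> p q; set Q := cset M p `&` cset M q.
  have Qp : Q `<=` cset M p by move=> x [].
  have Qq : Q `<=` cset M q by move=> x [].
  have QW : Q `<=` cset W p.1 `&` cset W q.1 by move=> x [[] ? _ [] ?].
  have QW' : Q `<=` cset W' p.2 `&` cset W' q.2 by move=> x [[] _ ? [] _ ?].
  have /= e := congr1 (res F Q) (E p.1 q.1).
  have /= e' := congr1 (res F Q) (E' p.2 q.2).
  rewrite resD resB !(res_resS _ QW) in e.
  rewrite resD resB !(res_resS _ QW') in e'.
  rewrite !(res_resS _ Qp) !(res_resS _ Qq) !resD !(res_resS _ Qp) !(res_resS _ Qq).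
  rewrite e.
  have Q1 : Q `<=` cset (tag z2) (r2 p.1) by move=> x /QW [/Wr2].
  have Q2 : Q `<=` cset (tag z2) (r2 q.1) by move=> x /QW [_ /Wr2].
  have Q3 : Q `<=` cset (tag z2) (s2 p.2) by move=> x /QW' [/Ws2].
  have Q4 : Q `<=` cset (tag z2) (s2 q.2) by move=> x /QW' [_ /Ws2].
  have e1 := cval_condS (tagged z2) Q1 Q3 Q4.
  have e2 := cval_condS (tagged z2) Q1 Q2 Q4.
  move: e1; rewrite e2 e' => /(canRL (addrK _)) ->.
  set A := res F Q (tagged z2 (r2 p.1) (s2 p.2)).
  set B := res F Q (tagged z2 (r2 q.1) (s2 q.2)).
  set Z := res F Q (tagged z3 _ _).
  set b1 := res F Q (b p.1); set b2 := res F Q (b q.1).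
  set c1 := res F Q (c p.2); set c2 := res F Q (c q.2).
  by rewrite !opprD !addrA [LHS](ACl (2*6*3*1*7*4*5)).
Qed.

HB.instance Definition _ := gen_eqMixin cocycle1.
HB.instance Definition _ := gen_choiceMixin cocycle1.

Definition cohomologousb (z z' : cocycle1) : bool := `[< cohomologous z z' >].

Lemma cohomologous_equiv : equiv_class_of cohomologousb.
Proof.
split.
- by move=> z; apply/asboolP; exact: cohomologous_refl.
- by move=> z z'; apply/asboolP/asboolP; exact: cohomologous_sym.
- move=> z2 z1 z3 /asboolP h12 /asboolP h23.
  by apply/asboolP; exact: cohomologous_trans h12 h23.
Qed.

Canonical cohomologous_equiv_rel := EquivRelPack cohomologous_equiv.

Definition H1 := {eq_quot cohomologousb}.

HB.instance Definition _ := Choice.on H1.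

Definition H1_class (V : cover X) (z : cocycle V) : H1 := \pi_H1 (Tagged cocycle z).

Lemma H1_classP (z z' : cocycle1) :
  H1_class (tagged z) = H1_class (tagged z') <-> cohomologous z z'.
Proof.
case: z z' => [V z] [V' z']; rewrite /H1_class /=; split.
  by move/eqmodP/asboolP.
by move=> h; apply/eqmodP/asboolP.
Qed.

Program Definition cocycle_scale (k : K) V (z : cocycle V) : cocycle V :=
  @Cocycle V (fun a b => k *: z a b) _ _.
Next Obligation.
move=> k V z a b; apply: secZ; first by apply: openI; exact: cset_open.
exact: cval_sec.
Qed.
Next Obligation. by move=> k V z a b c /=; rewrite !resZ cval_cond scalerDr. Qed.

Definition H1_scale (k : K) (x : H1) : H1 :=
  H1_class (cocycle_scale k (tagged (repr x))).

Lemma H1_scaleE k V (z : cocycle V) :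
  H1_scale k (H1_class z) = H1_class (cocycle_scale k z).
Proof.
rewrite /H1_scale; set y := repr _.
have : cohomologous y (Tagged cocycle z).
  by apply/H1_classP => /=; rewrite -[RHS]reprK /y /H1_class; case: (repr _).
move=> [W [r [r' [b [Wr Wr' bs E]]]]].
apply/(H1_classP (Tagged cocycle (cocycle_scale k (tagged y)))
  (Tagged cocycle (cocycle_scale k z))).
exists W, r, r', (fun w => k *: b w); split=> //.
- by move=> w; apply: secZ => //; exact: cset_open.
- by move=> v w /=; rewrite !resZ E scalerDr scalerBr.
Qed.

End H1.

(** * The sheaves O_X and T_X, line bundles, and tensor powers *)

(* Adds to a sheaf of K-vector spaces the multiplication by functions. *)
Record omodule (K : fieldType) (X : fspace K) := OModule {
  om_sheaf :> sheaf K X;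
  smul : (X -> K) -> amb om_sheaf -> amb om_sheaf;
  smul_lin : forall h a s t, smul h (a *: s + t) = a *: smul h s + smul h t;
  res_smul : forall V h s,
    res om_sheaf V (smul h s) = smul h (res om_sheaf V s);
  sec_smul : forall U h s, open U -> reg U h -> sec om_sheaf U s ->
    sec om_sheaf U (smul h s) }.

Section OModules.
Variables (K : fieldType) (X : fspace K).

Lemma restrE (E : nmodType) V (f : X -> E) x :
  restr V f x = if x \in V then f x else 0.
Proof. by []. Qed.

Lemma restrT (E : nmodType) (V : set X) (f : X -> E) x : V x -> restr V f x = f x.
Proof. by move=> Vx; rewrite restrE mem_set. Qed.

Lemma restrN (E : nmodType) (V : set X) (f : X -> E) x : ~ V x -> restr V f x = 0.
Proof. by move=> Vx; rewrite restrE memNset. Qed.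

Lemma restrI (E : nmodType) (U V : set X) (f : X -> E) :
  restr V (restr U f) = restr (U `&` V) f.
Proof. by apply/funext => x; rewrite !restrE in_setI; do 2!case: (x \in _). Qed.

Lemma restr_lin (E : lmodType K) (V : set X) a (f g : X -> E) :
  restr V (a *: f + g) = a *: restr V f + restr V g.
Proof.
apply/funext => x; transitivity (a *: restr V f x + restr V g x) => //; rewrite !restrE.
by case: ifP => // _; rewrite scaler0 addr0.
Qed.

Lemma regZ U a f : open U -> reg U f -> reg U (fun x : X => a * f x).
Proof.
move=> oU Uf; have -> : (fun x => a * f x) = (fun x => restr U (fun=> a) x * f x).
  apply/funext => x; have [Ux|Ux] := pselect (U x); first by rewrite restrT.
  by rewrite (reg_supp Uf Ux) !mulr0.
by apply: reg_mul => //; exact: reg_cst.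
Qed.

Lemma reg_lin U a f g : open U -> reg U f -> reg U g ->
  reg U (fun x : X => a * f x + g x).
Proof. by move=> oU Uf Ug; apply: reg_add => //; exact: regZ. Qed.

Lemma reg0 U : open U -> reg U (fun _ : X => 0).
Proof.
move=> oU; have := reg_cst 0 oU; congr reg; apply/funext => x.
by rewrite restrE if_same.
Qed.

Lemma reg_restrI U V f : open U -> open V -> reg U f ->
  reg (U `&` V) (restr V f : X -> K).
Proof.
move=> oU oV Uf; have -> : restr V f = restr (U `&` V) f.
  apply/funext => x; rewrite !restrE in_setI andbC.
  case: (x \in V) => //=; case: ifPn => // /negP Ux.
  by apply: (reg_supp Uf) => Ux'; apply: Ux; rewrite inE.
by apply: reg_restr Uf => //; exact: openI.
Qed.

Program Definition structure_sheaf : omodule X :=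
  @OModule K X
    (@Sheaf K X (X -> K^o) (@reg K X) (@restr X K^o) _ _ _ _ _)
    (fun h f x => h x * f x) _ _ _.
Next Obligation. by move=> U; exact: reg0. Qed.
Next Obligation. by move=> U a s t; exact: reg_lin. Qed.
Next Obligation. by move=> V a s t; exact: restr_lin. Qed.
Next Obligation. by move=> U V s; exact: restrI. Qed.
Next Obligation. by move=> U V s; exact: reg_restrI. Qed.
Next Obligation.
move=> h a s t; apply/funext => x.
have E (u v : K) : h x * (a * u + v) = a * (h x * u) + h x * v by ring.
exact: E.
Qed.
Next Obligation.
by move=> V h s; apply/funext => x /=; rewrite !restrE; case: ifP; rewrite ?mulr0.
Qed.
Next Obligation. by move=> U h s; exact: reg_mul. Qed.

(* A section of T_X over U is a K-derivation of the sheaf of algebras O_X|U: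
   a family of derivations of the algebras O(W), for W open in U, compatible
   with restriction. The first clause only normalizes junk values. *)
Definition derivation (U : set X) (D : set X -> (X -> K) -> X -> K) :=
  (forall W f, ~ [/\ open W, W `<=` U & reg W f] -> D W f = 0) /\
  forall W, open W -> W `<=` U ->
  [/\ forall f, reg W f -> reg W (D W f),
      forall a f g, reg W f -> reg W g ->
        D W (fun x => a * f x + g x) = (fun x => a * D W f x + D W g x),
      forall f g, reg W f -> reg W g ->
        D W (fun x => f x * g x) = (fun x => f x * D W g x + g x * D W f x)
    & forall V f, open V -> V `<=` W -> reg W f ->
        D V (restr V f) = restr V (D W f)].

Definition res_derivation (V : set X) (D : set X -> (X -> K) -> X -> K^o) :
    set X -> (X -> K) -> X -> K^o :=
  fun W f => if `[< W `<=` V >] then D W f else 0.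

Program Definition tangent_sheaf : omodule X :=
  @OModule K X
    (@Sheaf K X (set X -> (X -> K) -> X -> K^o) derivation res_derivation
       _ _ _ _ _)
    (fun h D W f x => h x * D W f x) _ _ _.
Next Obligation.
move=> U oU; split=> // W oW WU; split.
- by move=> f _; exact: reg0.
- by move=> a f g _ _; apply/funext => x /=; rewrite mulr0 addr0.
- by move=> f g _ _; apply/funext => x /=; rewrite !mulr0 addr0.
- by move=> V f _ _ _; apply/funext => x; rewrite restrE if_same.
Qed.
Next Obligation.
move=> U a D E oU [D0 DP] [E0 EP]; split.
  move=> W f h; transitivity (a *: D W f + E W f) => //.
  by rewrite D0 // E0 // scaler0 addr0.
move=> W oW WU; have [D1 D2 D3 D4] := DP W oW WU.
have [E1 E2 E3 E4] := EP W oW WU; split.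
- by move=> f Wf; apply: reg_lin => //; [exact: D1|exact: E1].
- move=> b f g Wf Wg; set p := (fun x => _); transitivity (a *: D W p + E W p) => //.
  rewrite /p D2 // E2 //; apply/funext => x.
  have H (u v w z : K) : a * (b * u + v) + (b * w + z) =
    b * (a * u + w) + (a * v + z) by ring.
  exact: H.
- move=> f g Wf Wg; set p := (fun x => _); transitivity (a *: D W p + E W p) => //.
  rewrite /p D3 // E3 //; apply/funext => x.
  have H (u v w z : K) : a * (f x * u + g x * v) + (f x * w + g x * z) =
    f x * (a * u + w) + g x * (a * v + z) by ring.
  exact: H.
- move=> V f oV VW Wf.
  transitivity (a *: D V (restr V f) + E V (restr V f)) => //.
  by rewrite D4 // E4 //; symmetry; exact: (@restr_lin K^o).
Qed.
Next Obligation.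
move=> V a D E; apply/funext => W; apply/funext => f.
transitivity (a *: res_derivation V D W f + res_derivation V E W f) => //.
by rewrite /res_derivation; case: ifP => // _; rewrite scaler0 addr0.
Qed.
Next Obligation.
move=> U V D; apply/funext => W; apply/funext => f.
rewrite /res_derivation; have -> : `[< W `<=` U `&` V >] =
    `[< W `<=` U >] && `[< W `<=` V >].
  by rewrite -asbool_and; congr asbool; apply/propext; rewrite subsetI.
by case: `[< W `<=` V >]; rewrite ?andbT ?andbF.
Qed.
Next Obligation.
move=> U V D oU oV [D0 DP]; split.
  move=> W f h; rewrite /res_derivation; case: asboolP => // WV.
  rewrite D0 // => -[oW WU Wf]; apply: h; split=> // x Wx; split; [exact: WU|exact: WV].
move=> W oW WUV; have WU : W `<=` U by move=> x /WUV[].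
have WV : W `<=` V by move=> x /WUV[].
have -> : res_derivation V D W = D W by rewrite /res_derivation asboolT.
have [D1 D2 D3 D4] := DP W oW WU; split=> // V' f oV' V'W Wf.
by rewrite /res_derivation asboolT ?D4 // => x /V'W /WV.
Qed.
Next Obligation.
move=> h a D E; apply/funext => W; apply/funext => f; apply/funext => x.
have H (u v : K) : h x * (a * u + v) = a * (h x * u) + h x * v by ring.
exact: H.
Qed.
Next Obligation.
move=> V h D; apply/funext => W; apply/funext => f; apply/funext => x.
by rewrite /= /res_derivation; case: ifP => // _; rewrite mulr0.
Qed.
Next Obligation.
move=> U h D oU Uh [D0 DP]; split.
  by move=> W f nf; apply/funext => x; rewrite D0 //= mulr0.
move=> W oW WU; have [D1 D2 D3 D4] := DP W oW WU; split.
- move=> f Wf; have -> : (fun x => h x * D W f x) =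
      (fun x => restr W h x * D W f x).
    apply/funext => x; have [Wx|Wx] := pselect (W x); first by rewrite restrT.
    by rewrite (reg_supp (D1 _ Wf) Wx) !mulr0.
  by apply: reg_mul => //; [exact: reg_restr Uh|exact: D1].
- by move=> a f g Wf Wg; apply/funext => x; rewrite D2 //; ring.
- by move=> f g Wf Wg; apply/funext => x; rewrite D3 //; ring.
- move=> V f oV VW Wf; apply/funext => x; rewrite D4 //.
  by rewrite !restrE; case: ifP; rewrite ?mulr0.
Qed.

(* A line bundle L, given by trivializations over the members of an open cover.
   The function [lb_nu i j] is the transition function from the trivialization
   over U_j to the one over U_i. *)
Record line_bundle := LineBundle {
  lb_cover : cover X;
  lb_nu : lb_cover -> lb_cover -> X -> K;
  lb_reg : forall i j,
    reg (cset lb_cover i `&` cset lb_cover j) (lb_nu i j);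
  lb_refl : forall i x, cset lb_cover i x -> lb_nu i i x = 1;
  lb_cocycle : forall i j k x,
    cset lb_cover i x -> cset lb_cover j x -> cset lb_cover k x ->
    lb_nu i j x * lb_nu j k x = lb_nu i k x }.

(* M (x) L^k: a section over V is the family of its expressions s_i in the
   trivializations of L, with s_i = nu_ij^k s_j. *)
Program Definition tensor_pow (M : omodule X) (L : line_bundle) (k : nat) :
    sheaf K X :=
  let U := cset (lb_cover L) in
  @Sheaf K X (lb_cover L -> amb M)
    (fun V s =>
       (forall i, sec M (V `&` U i) (s i)) /\
       forall i j, let Q := V `&` (U i `&` U j) in
         res M Q (s i) = smul (fun x => lb_nu i j x ^+ k) (res M Q (s j)))
    (fun V s i => res M V (s i)) _ _ _ _ _.
Next Obligation.
move=> M L k U V oV; split=> [i|i j].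
  by apply: sec0; apply: openI => //; exact: cset_open.
have smul0 h : smul h (0 : amb M) = 0.
  have := smul_lin h (-1) (0 : amb M) 0.
  by rewrite !scaleN1r oppr0 addr0 addNr.
by rewrite /= !res0 smul0.
Qed.
Next Obligation.
move=> M L k U V a s t oV [s1 s2] [t1 t2]; split=> [i|i j].
  by apply: sec_lin => //; apply: openI => //; exact: cset_open.
by rewrite /= !res_lin s2 t2 smul_lin.
Qed.
Next Obligation.
by move=> M L k U V a s t; apply/funext => i; exact: res_lin.
Qed.
Next Obligation. by move=> M L k U V W s; apply/funext => i; exact: res_res. Qed.
Next Obligation.
move=> M L k U V W s oV oW [s1 s2]; split=> [i|i j] /=.
  rewrite setIAC; apply: sec_res => //; apply: openI => //; exact: cset_open.
set N := cset (lb_cover L) i `&` cset (lb_cover L) j.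
have E : W `&` (V `&` W `&` N) = V `&` N `&` W.
  by rewrite setIAC setIC -setIA setIid.
have := congr1 (res M W) (s2 i j); rewrite /= res_smul !res_res -/N.
by rewrite E.
Qed.

End OModules.
(** * Truncated polynomial algebras and their automorphisms *)

Record alg_sheaf (K : fieldType) (X : topologicalType) := AlgSheaf {
  al_amb : lmodType K;
  al_sec : set X -> set al_amb;
  al_res : set X -> al_amb -> al_amb;
  al_one : set X -> al_amb;
  al_mul : al_amb -> al_amb -> al_amb }.
Arguments al_sec {K X} A U _ : rename.
Arguments al_res {K X} A V _ : rename.
Arguments al_one {K X} A U : rename.
Arguments al_mul {K X} A _ _ : rename.

(* phi is an automorphism of the restriction to U of the sheaf of K-algebras A:
   a family of automorphisms phi V, for V open in U. *)
Definition alg_sheaf_aut (K : fieldType) (X : topologicalType)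
    (A : alg_sheaf K X) (U : set X) (phi : set X -> al_amb A -> al_amb A) :=
  forall V, open V -> V `<=` U ->
  [/\ set_bij (al_sec A V) (al_sec A V) (phi V),
      forall a s t, al_sec A V s -> al_sec A V t ->
        phi V (a *: s + t) = a *: phi V s + phi V t,
      forall s t, al_sec A V s -> al_sec A V t ->
        phi V (al_mul A s t) = al_mul A (phi V s) (phi V t),
      phi V (al_one A V) = al_one A V
    & forall W s, open W -> W `<=` V -> al_sec A V s ->
        phi W (al_res A W s) = al_res A W (phi V s)].

Section Truncated.
Variables (K : fieldType) (X : fspace K).

(* The sheaf O_X[t]/(t^m). The element f_0 + f_1 t + ... + f_(m-1) t^(m-1) of
   O(U)[t]/(t^m) is represented by the function sending x to the polynomial with
   coefficients f_0(x), ..., f_(m-1)(x), t being the polynomial variable 'X. *)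
Definition trunc_sheaf (m : nat) : alg_sheaf K X :=
  @AlgSheaf K X (X -> {poly K})
    (fun U F => (forall x, (size (F x) <= m)%N) /\
                forall k, reg U (fun x => (F x)`_k))
    (@restr X {poly K})
    (fun U => restr U (fun=> take_poly m 1))
    (fun F G x => take_poly m (F x * G x)).

Definition local_map := set X -> (X -> {poly K}) -> X -> {poly K}.

(* The group G_m(U). *)
Definition Gm (m : nat) (U : set X) (phi : local_map) :=
  alg_sheaf_aut (A := trunc_sheaf m) U phi /\
  forall V F x, open V -> V `<=` U -> al_sec (trunc_sheaf m) V F ->
    (phi V F x)`_0 = (F x)`_0.

Definition Gm_inv (m : nat) (phi : local_map) : local_map :=
  fun V => pinv_ (fun=> 0) (al_sec (trunc_sheaf m) V) (phi V).

(* The endomorphism of O_X[t]/(t^m) given by f |-> alpha(f) and t |-> tau. *)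
Definition tmap (m : nat) (alpha : set X -> (X -> K) -> X -> {poly K})
    (tau : X -> {poly K}) : local_map :=
  fun V F x => take_poly m
    (\sum_(k < m) alpha V (fun y => (F y)`_k) x * tau x ^+ k).

(* f |-> f, t |-> c t. *)
Definition tscale (m : nat) (c : X -> K) : local_map :=
  tmap m (fun _ f x => (f x)%:P) (fun x => c x *: 'X).

(* f |-> f + D(f) t^n, t |-> (1 + h t^(n-1)) t, in G_(n+1). *)
Definition gamma (n : nat) (h : X -> K) (D : set X -> (X -> K) -> X -> K) :
    local_map :=
  tmap n.+1 (fun V f x => (f x)%:P + D V f x *: 'X^n)
    (fun x => (1 + h x *: 'X^(n.-1)) * 'X).

Definition is_lift (n : nat) (U : set X) (c chi : local_map) :=
  forall V F, open V -> V `<=` U -> al_sec (trunc_sheaf n.+1) V F ->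
    (fun x => take_poly n (c V F x)) = chi V (fun x => take_poly n (F x)).

Variable L : line_bundle X.
Let U := cset (lb_cover L).

(* The structure sheaf of X_n, which is obtained by gluing the sheaves
   O_(U_i)[t]/(t^n) along t |-> nu_ij t, i.e. the direct sum of the L^k, k < n.
   A section over V is the family of its expressions over the V /\ U_i. *)
Definition Xn_sheaf (n : nat) : alg_sheaf K X :=
  @AlgSheaf K X (lb_cover L -> X -> {poly K})
    (fun V s =>
       (forall i, al_sec (trunc_sheaf n) (V `&` U i) (s i)) /\
       forall i j, let Q := V `&` (U i `&` U j) in
         restr Q (s i) = tscale n (lb_nu i j) Q (restr Q (s j)))
    (fun V s i => restr V (s i))
    (fun V i => restr (V `&` U i) (fun=> take_poly n 1))
    (fun s t i x => take_poly n (s i x * t i x)).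

(* Automorphisms of X_n inducing the identity on X, through their action chi^*
   on the structure sheaf. *)
Record AutXn (n : nat) := MkAutXn {
  aut_fun :> set X -> (lb_cover L -> X -> {poly K}) ->
             lb_cover L -> X -> {poly K};
  aut_aut : alg_sheaf_aut (A := Xn_sheaf n) setT aut_fun;
  aut_id : forall V s i x, open V -> al_sec (Xn_sheaf n) V s ->
    (aut_fun V s i x)`_0 = (s i x)`_0 }.

(* chi_i is the expression over V `<=` U_i of chi^* in the trivialization of
   X_n over U_i. *)
Definition local_expr n (chi : AutXn n) i (V : set X) (chi_i : local_map) :=
  Gm n V chi_i /\
  forall W s, open W -> W `<=` V -> al_sec (Xn_sheaf n) W s ->
    chi W s i = chi_i W (s i).

Definition H1_ext n : Type :=
  (H1 (tensor_pow (structure_sheaf X) L n.-1) *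
   H1 (tensor_pow (tangent_sheaf X) L n))%type.

(* y is the class defined by
     theta_ab = c_a gamma_ab g_ab c_b^-1 g_ab^-1,
   computed on a cover V refining (U_i) by means of rho: the functions eta_ab
   and vector fields eps_ab are the components e a b (rho a), d a b (rho a) of
   the cocycles e and d in the trivialization of L over U_(rho a), and g_ab is
   t |-> nu t for the transition function nu of L from rho b to rho a. *)
Definition acts_to n (chi : AutXn n) (x y : H1_ext n) : Prop :=
  exists (V : cover X) (rho : V -> lb_cover L)
    (e e' : cocycle (tensor_pow (structure_sheaf X) L n.-1) V)
    (d d' : cocycle (tensor_pow (tangent_sheaf X) L n) V)
    (chi_ c : V -> local_map),
  [/\ forall a, cset V a `<=` U (rho a),
      x = (H1_class e, H1_class d), y = (H1_class e', H1_class d'),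
      forall a, [/\ local_expr chi (rho a) (cset V a) (chi_ a),
                    Gm n.+1 (cset V a) (c a)
                  & is_lift n (cset V a) (c a) (chi_ a)]
    & forall a b W F, open W -> W `<=` cset V a `&` cset V b ->
        al_sec (trunc_sheaf n.+1) W F ->
        let g := tscale n.+1 (lb_nu (rho a) (rho b)) in
        (c a W \o gamma n (e a b (rho a)) (d a b (rho a)) W \o g W
           \o Gm_inv n.+1 (c b) W \o Gm_inv n.+1 g W) F =
        gamma n (e' a b (rho a)) (d' a b (rho a)) W F].

(* chi . x; the default value x is irrelevant: on a smooth variety, and for
   n >= 2, [acts_to chi] is the graph of a function. *)
Definition Aut_act n (chi : AutXn n) (x : H1_ext n) : H1_ext n :=
  xget x [set y | acts_to chi x y].

Definition scalar_fun n (l : K) (V : set X) (s : lb_cover L -> X -> {poly K})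
    (i : lb_cover L) : X -> {poly K} :=
  tscale n (fun=> l) V (s i).

Lemma coef_tscale m c V (F : X -> {poly K}) x k :
  (tscale m c V F x)`_k = if (k < m)%N then (F x)`_k * c x ^+ k else 0.
Proof.
rewrite /tscale /tmap coef_take_poly; case: ltnP => // km.
rewrite coef_sum (bigD1 (Ordinal km)) //= big1 ?addr0 => [|i ik].
  by rewrite coefCM exprZn coefZ coefXn eqxx mulr1.
rewrite coefCM exprZn coefZ coefXn; case: eqP => [e|]; last by rewrite !mulr0.
by case/eqP: ik; apply/val_inj.
Qed.

Lemma size_tscale m c V (F : X -> {poly K}) x : (size (tscale m c V F x) <= m)%N.
Proof. by rewrite /tscale /tmap size_take_poly. Qed.

Lemma coef_restr V (F : X -> {poly K}) x k :
  (restr V F x)`_k = restr V (fun y => (F y)`_k) x.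
Proof. by rewrite !restrE; case: ifP; rewrite ?coef0. Qed.

Lemma trunc_lt m V (F : X -> {poly K}) x k :
  al_sec (trunc_sheaf m) V F -> (m <= k)%N -> (F x)`_k = 0.
Proof. by move=> [Fm _] mk; rewrite nth_default // (leq_trans (Fm x)). Qed.

Lemma trunc_supp m V (F : X -> {poly K}) x :
  al_sec (trunc_sheaf m) V F -> ~ V x -> F x = 0.
Proof. by move=> [_ Fr] Vx; apply/polyP => k; rewrite coef0 (reg_supp (Fr k)). Qed.

Lemma tscale_sec m (a : K) V F : open V -> al_sec (trunc_sheaf m) V F ->
  al_sec (trunc_sheaf m) V (tscale m (fun=> a) V F).
Proof.
move=> oV FV; split=> [x|k]; first exact: size_tscale.
have -> : (fun x => (tscale m (fun=> a) V F x)`_k) = (fun x => a ^+ k * (F x)`_k).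
  apply/funext => x; rewrite coef_tscale; case: ltnP => [_|mk].
    by rewrite mulrC.
  by rewrite (trunc_lt _ FV mk) mulr0.
by apply: regZ => //; case: FV.
Qed.

Lemma scalar_sec n (a : K) V s : open V -> al_sec (Xn_sheaf n) V s ->
  al_sec (Xn_sheaf n) V (scalar_fun n a V s).
Proof.
move=> oV [s1 s2]; split=> [i|i j Q].
  by apply: tscale_sec => //; apply: openI => //; exact: cset_open.
have eij := s2 i j; apply/funext => x; apply/polyP => k.
have := congr1 (fun F : X -> {poly K} => (F x)`_k) (eij : restr Q _ = _).
rewrite /= coef_restr coef_tscale coef_restr coef_tscale coef_restr /scalar_fun.
rewrite -/Q !restrE !coef_tscale; case: ifP => [_|_].
  by case: ifP => // kn ->; rewrite coef_tscale kn -!mulrA [_ * a ^+ k]mulrC.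
by rewrite coef0 mul0r if_same.
Qed.

Lemma scalarK n (a b : K) V s : a * b = 1 -> al_sec (Xn_sheaf n) V s ->
  scalar_fun n a V (scalar_fun n b V s) = s.
Proof.
move=> ab [s1 _]; apply/funext => i; apply/funext => x; apply/polyP => k.
rewrite !coef_tscale; case: ltnP => [km|mk].
  by rewrite -mulrA -exprMn mulrC mulrC [b * a]mulrC ab expr1n mulr1.
by rewrite (trunc_lt _ (s1 i) mk).
Qed.

Section Scalar.
Variables (n : nat) (l : K) (l0 : l != 0).

Lemma scalar_aut_subproof :
  alg_sheaf_aut (A := Xn_sheaf n) setT (scalar_fun n l).
Proof.
have lV : l * l^-1 = 1 by rewrite divff.
have Vl : l^-1 * l = 1 by rewrite mulVf.
move=> V oV _; split.
- split=> [s|s t|s].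
  + exact: scalar_sec.
  + move=> /set_mem sV /set_mem tV e.
    by rewrite -(scalarK Vl sV) e (scalarK Vl tV).
  + move=> sV; exists (scalar_fun n l^-1 V s); first exact: scalar_sec.
    exact: scalarK.
- move=> a s t sV tV; apply/funext => i; apply/funext => x; apply/polyP => k.
  have E (p q : {poly K}) : (if (k < n)%N then (a *: p + q)`_k * l ^+ k else 0) =
      a * (if (k < n)%N then p`_k * l ^+ k else 0) +
      (if (k < n)%N then q`_k * l ^+ k else 0).
    case: ifP => _; first by rewrite coefD coefZ mulrDl -mulrA.
    by rewrite mulr0 addr0.
  apply: etrans (coef_tscale _ _ _ ((a *: s + t) i) _ _) _.
  apply: etrans (E _ _) _; apply: esym.
  apply: etrans (coefD (a *: scalar_fun n l V s i x) (scalar_fun n l V t i x) k) _.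
  by rewrite coefZ !coef_tscale.
- move=> s t sV tV; apply/funext => i; apply/funext => x; apply/polyP => k.
  rewrite coef_tscale /= !coef_take_poly; case: ltnP => // km.
  rewrite !coefM mulr_suml; apply: eq_bigr => j _.
  have jk : (j <= k)%N by rewrite -ltnS.
  rewrite !coef_tscale (leq_ltn_trans jk km) (leq_ltn_trans (leq_subr _ _) km).
  by rewrite mulrACA -exprD subnKC.
- apply/funext => i; apply/funext => x; apply/polyP => k.
  rewrite coef_tscale /= coef_restr restrE.
  case: (x \in _); last by rewrite mul0r if_same.
  rewrite coef_take_poly coef1; case: ltnP => // _.
  by case: eqP => [->|_]; rewrite ?mul0r ?expr0 ?mulr1.
- move=> W s oW WV sV; apply/funext => i; apply/funext => x; apply/polyP => k.
  rewrite coef_tscale /= !coef_restr !restrE coef_tscale.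
  by case: (x \in _); rewrite ?mul0r ?if_same.
Qed.

Lemma scalar_id_subproof V s i x : open V -> al_sec (Xn_sheaf n) V s ->
  (scalar_fun n l V s i x)`_0 = (s i x)`_0.
Proof.
move=> oV [s1 _]; rewrite coef_tscale expr0 mulr1; case: ltnP => // n0.
by rewrite (trunc_lt _ (s1 i) n0).
Qed.

(* The automorphism of X_n induced by the multiplication by l in L^*, i.e.
   t |-> l t in each trivialization. *)
Definition scalar_aut : AutXn n := MkAutXn scalar_aut_subproof scalar_id_subproof.

End Scalar.
End Truncated.

(* Main.v *)
(* If c_a in G_(n+1) lifts t |-> l t, then, since n >= 2,
     c_a(F) = sum_(k <= n) l^k F_k t^k + (D_a(F_0) + h_a F_1) t^n
   for some function h_a and vector field D_a. As
   theta_ab = c_a gamma_ab g_ab c_b^-1 g_ab^-1 is gamma(e', d') exactly when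
   c_a gamma_ab g_ab = gamma(e', d') g_ab c_b, comparing the coefficients of t^n
   gives
     e'_ab = l^(n-1) e_ab + l^-1 (h_a - nu_ab^(n-1) h_b),
     d'_ab = l^n d_ab + D_a - nu_ab^n D_b,
   so the class of theta does not depend on the lifts, and the lifts
   c_a : t |-> l t show that it is (l^(n-1) eta, l^n eps). *)
Require Import Defs.
From mathcomp Require Import all_boot all_order all_algebra.
From mathcomp Require Import complex ring.
From mathcomp Require Import boolp classical_sets functions reals topology.

Set Implicit Arguments.
Unset Strict Implicit.
Unset Printing Implicit Defensive.

Import GRing.Theory.
Local Open Scope classical_set_scope.
Local Open Scope ring_scope.

(** * Coefficients of [gamma] and of the scalings t |-> c t *)

Section Coefficients.
Variables (K : fieldType) (X : fspace K).

(** Modulo t^(n+1), the term d t^n survives only against t^0, and h t^(n-1) only against t^1, since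
    each extra factor t pushes it past degree n. *)
Lemma coef_gamma_term (n j k : nat) (f d h : K) : (2 <= n)%N -> (k <= n)%N ->
  ((f%:P + d *: 'X^n) * ((1 + h *: 'X^(n.-1)) * 'X) ^+ j)`_k =
  f *+ (j == k) +
  (if k == n then (if j == 0%N then d else 0) + (if j == 1%N then h * f else 0)
   else 0).
Proof.
case: n => [|[|m]] // _ km.
have high (q : {poly K}) : ('X^(m.+3) * q)`_k = 0 by rewrite coefXnM ltnS km.
case: j => [|[|j]] /=.
- rewrite expr0 mulr1 coefD coefC coefZ coefXn eq_sym.
  by case: (0%N == k); case: (k == m.+2); rewrite /= ?mulr1 ?mulr0 ?addr0.
- have -> : (f%:P + d *: 'X^(m.+2)) * ((1 + h *: 'X^(m.+1)) * 'X) ^+ 1 =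
      f *: 'X + (h * f) *: 'X^(m.+2) + 'X^(m.+3) * (d%:P + (d * h) *: 'X^(m.+1)).
    by rewrite -!mul_polyC !polyCM !exprS expr0; ring.
  rewrite !coefD !coefZ high coefX coefXn addr0 [1%N == k]eq_sym.
  by case: (k == 1%N); case: (k == m.+2); rewrite /= ?mulr1 ?mulr0 ?add0r ?addr0.
(* Here n is [m.+2]. Every power of 1 + h t^(n-1) is 1 modulo t^(n-1), and the remaining factor
   t^(j+2) lifts the error to degree at least n+1. *)
- rewrite exprMn; have [r ->] : exists r,
      (1 + h *: 'X^(m.+1)) ^+ j.+2 = 1 + 'X^(m.+1) * r.
    elim: j.+2 => [|i [r IH]]; first by exists 0; rewrite expr0 mulr0 addr0.
    exists (h%:P + r + h%:P * 'X^(m.+1) * r).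
    by rewrite exprS IH -!mul_polyC !exprS; ring.
  have -> : (f%:P + d *: 'X^(m.+2)) * ((1 + 'X^(m.+1) * r) * 'X^(j.+2)) =
      f *: 'X^(j.+2) + 'X^(m.+3) *
        ('X^j * (f%:P * r + d%:P * 'X + d%:P * 'X^(m.+2) * r)).
    by rewrite -!mul_polyC !exprS; ring.
  rewrite coefD high coefZ coefXn addr0 addr0 if_same addr0 eq_sym.
  by rewrite mulr_natr.
Qed.

(** In coefficients, [gamma] is F |-> F + (D(F_0) + h F_1) t^n; this additive form is what all later
    comparisons use. *)
Lemma coef_gamma (n : nat) (h : X -> K) D V (F : X -> {poly K}) x k :
  (2 <= n)%N ->
  (gamma n h D V F x)`_k =
  if (k <= n)%N then (F x)`_k +
    (if k == n then D V (fun y => (F y)`_0) x + h x * (F x)`_1 else 0) else 0.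
Proof.
move=> n2; rewrite /gamma /tmap coef_take_poly ltnS; case: ifP => // kn.
rewrite coef_sum; under eq_bigr => j _ do rewrite (coef_gamma_term j _ _ _ n2 kn).
rewrite big_split /= (bigD1 (Ordinal (kn : (k < n.+1)%N))) //= eqxx.
rewrite [X in _ + X + _]big1 ?addr0 => [|i /negbTE ik]; last first.
  by rewrite -(inj_eq val_inj) /= in ik; rewrite ik.
congr (_ + _); case: eqP => _; last by rewrite big1.
case: n n2 {kn} => [|[|n]] // _.
by rewrite big_ord_recl big_ord_recl big1 //= !addr0 ?add0r.
Qed.

(** Regularity is asked of [restr U c] so that [c] may be a constant, which is not extended by zero,
    as well as a transition function. *)
Lemma tscale_section (m : nat) (U V : set X) c F : open U -> open V -> V `<=` U ->
  reg U (restr U c : X -> K) -> al_sec (trunc_sheaf X m) V F ->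
  al_sec (trunc_sheaf X m) V (tscale m c V F).
Proof.
move=> oU oV VU cU FV; split=> [x|k]; first exact: size_tscale.
have -> : (fun x => (tscale m c V F x)`_k) =
    (fun x => restr V (restr U c : X -> K) x ^+ k * (F x)`_k).
  apply/funext => x; rewrite coef_tscale.
  have [Vx|Vx] := pselect (V x); last first.
    by rewrite (trunc_supp FV Vx) coef0 mul0r mulr0 if_same.
  rewrite restrT // restrT; last exact: VU.
  by case: ltnP => [_|mk]; rewrite ?(trunc_lt _ FV mk) ?mulr0 // mulrC.
have cV : reg V (restr V (restr U c : X -> K)) by exact: reg_restr cU.
(* Induction on the exponent alone; the index of the coefficient of F stays fixed. *)
elim: {1}k => [|j IH].
  by case: FV => _ /(_ k); congr reg; apply/funext => x; rewrite expr0 mul1r.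
have := reg_mul oV cV IH; congr reg; apply/funext => x.
by rewrite exprS mulrA.
Qed.

Lemma tscaleK m (V : set X) (c c' : X -> K) F :
  (forall x, V x -> c x * c' x = 1) -> al_sec (trunc_sheaf X m) V F ->
  tscale m c' V (tscale m c V F) = F.
Proof.
move=> cc FV; apply/funext => x; apply/polyP => k; rewrite !coef_tscale.
case: ltnP => [km|mk]; last by rewrite (trunc_lt _ FV mk).
have [Vx|Vx] := pselect (V x); last by rewrite (trunc_supp FV Vx) coef0 !mul0r.
by rewrite -mulrA -exprMn cc // expr1n mulr1.
Qed.

Lemma tscale_Gm m (U : set X) (c c' : X -> K) : open U ->
  reg U (restr U c : X -> K) -> reg U (restr U c' : X -> K) ->
  (forall x, U x -> c x * c' x = 1) -> Gm m U (tscale m c).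
Proof.
move=> oU cU c'U cc; split; last first.
  move=> V F x oV VU FV; rewrite coef_tscale expr0 mulr1; case: ltnP => // m0.
  by rewrite (trunc_lt _ FV m0).
move=> V oV VU; have secV := tscale_section oU oV VU cU.
have secV' := tscale_section oU oV VU c'U.
have ccV x : V x -> c x * c' x = 1 by move=> /VU; exact: cc.
have ccV' x : V x -> c' x * c x = 1 by move=> /ccV; rewrite mulrC.
split.
- split=> [F|F G /set_mem FV /set_mem GV e|F FV].
  + exact: secV.
  + by rewrite -(tscaleK ccV FV) e (tscaleK ccV GV).
  + exists (tscale m c' V F); first exact: secV'.
    exact: tscaleK ccV' FV.
- move=> a F G FV GV; apply/funext => x; apply/polyP => k.
  rewrite [RHS](_ : _ = (a *: tscale m c V F x + tscale m c V G x)`_k) //.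
  rewrite coefD coefZ !coef_tscale.
  rewrite (_ : ((a *: F + G) x)`_k = a * (F x)`_k + (G x)`_k); last first.
    by rewrite -coefZ -coefD.
  by case: ifP => _; rewrite ?mulr0 ?addr0 // mulrDl mulrA.
- move=> F G FV GV; apply/funext => x; apply/polyP => k.
  rewrite coef_tscale /= !coef_take_poly; case: ltnP => // km.
  rewrite !coefM mulr_suml; apply: eq_bigr => j _.
  have jk : (j <= k)%N by rewrite -ltnS.
  rewrite !coef_tscale (leq_ltn_trans jk km) (leq_ltn_trans (leq_subr _ _) km).
  by rewrite mulrACA -exprD subnKC.
- apply/funext => x; apply/polyP => k.
  rewrite coef_tscale /= coef_restr restrE.
  case: (x \in _); last by rewrite mul0r if_same.
  rewrite coef_take_poly coef1; case: ltnP => // _.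
  by case: eqP => [->|_]; rewrite ?mul0r ?expr0 ?mulr1.
- move=> W F oW WV FV; apply/funext => x; apply/polyP => k.
  rewrite coef_tscale /= !coef_restr !restrE coef_tscale.
  by case: (x \in _); rewrite ?mul0r ?if_same.
Qed.

End Coefficients.

(** * Normal form of the lifts of t |-> l t *)

Section Lifts.
Variables (K : fieldType) (X : fspace K) (L : line_bundle X).
Let U := cset (lb_cover L).

Lemma restr_reg (V : set X) (f : X -> K) : reg V f -> restr V f = f.
Proof.
move=> Vf; apply/funext => x; have [Vx|Vx] := pselect (V x).
  by rewrite restrT.
by rewrite restrN // (reg_supp Vf).
Qed.

(** The expression over U_j is G transported by t |-> nu_ji t. As [local_expr] constrains chi_i only
    on expressions of sections of X_n, this makes it a constraint on every truncated polynomial. *)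
Lemma Xn_extend n i (W : set X) G : open W -> W `<=` U i ->
  al_sec (trunc_sheaf X n) W G ->
  exists s, al_sec (Xn_sheaf L n) W s /\ s i = G.
Proof.
move=> oW WU GW.
pose s j := tscale n (lb_nu j i) (W `&` U j) (restr (U j) G).
have oU j : open (U j) by exact: cset_open.
exists s; split; first split=> [j|j k Q].
- apply: (tscale_section (U := U j `&` U i)).
  + exact: openI.
  + exact: openI.
  + by move=> x [/WU].
  + by rewrite restr_reg; exact: lb_reg.
  + split=> [x|k].
      by rewrite restrE; case: ifP => _; [case: GW|rewrite size_poly0].
    have := reg_restrI oW (oU j) (GW.2 k); congr reg.
    by apply/funext => x; rewrite coef_restr.
- apply/funext => x; apply/polyP => m; rewrite coef_tscale !coef_restr.
  have [Qx|Qx] := pselect (Q x); last by rewrite !(restrN _ Qx) mul0r if_same.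
  rewrite !(restrT _ Qx) !coef_tscale; case: ltnP => // mn.
  have [Wx [Ujx Ukx]] := Qx; rewrite !restrT //.
  (* Compatibility of the expressions is nu_jk nu_ki = nu_ji, raised to the power of the
     coefficient. *)
  by rewrite -(lb_cocycle Ujx Ukx (WU x Wx)) exprMn mulrCA mulrC.
- apply/funext => x; apply/polyP => m; rewrite coef_tscale coef_restr.
  case: ltnP => [mn|nm]; last by rewrite (trunc_lt _ GW nm).
  have [Wx|Wx] := pselect (W x); last first.
    by rewrite restrE !(trunc_supp GW Wx) coef0 if_same mul0r.
  have Ux := WU x Wx.
  by rewrite restrT // lb_refl // expr1n mulr1.
Qed.

(** A lift agrees with chi_i below t^n, and chi_i is t |-> l t on every truncated polynomial because
    each one extends to a section of X_n. *)
Lemma scalar_lift_coef n (l : K) (l0 : l != 0) i (V : set X) c chi :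
  V `<=` U i -> local_expr (scalar_aut L n l0) i V chi -> is_lift n V c chi ->
  forall W F x k, open W -> W `<=` V -> al_sec (trunc_sheaf X n.+1) W F ->
  (k < n)%N -> (c W F x)`_k = l ^+ k * (F x)`_k.
Proof.
move=> VU [_ chiE] cE W F x k oW WV FW kn.
have FW' : al_sec (trunc_sheaf X n) W (fun y => take_poly n (F y)).
  split=> [y|j]; first exact: size_take_poly.
  have [jn|nj] := ltnP j n.
    by have := FW.2 j; congr reg; apply/funext => y; rewrite coef_take_poly jn.
  have := reg0 oW; congr reg; apply/funext => y.
  by rewrite coef_take_poly ltnNge nj.
have WU : W `<=` U i by move=> y /WV /VU.
have [s [sW si]] := Xn_extend oW WU FW'.
have := chiE W s oW WV sW; rewrite si -(cE W F oW WV FW).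
move=> /(congr1 (fun G : X -> {poly K} => (G x)`_k)).
rewrite /= [RHS]coef_take_poly kn => <-.
by rewrite /scalar_fun coef_tscale kn si coef_take_poly kn mulrC.
Qed.

Lemma polyC_section m (W : set X) (f : X -> K) : (0 < m)%N -> open W ->
  reg W f -> al_sec (trunc_sheaf X m) W (fun x => (f x)%:P).
Proof.
move=> m0 oW Wf; split=> [x|k].
  by rewrite size_polyC; case: eqP.
case: k => [|k].
  by move: Wf; congr reg; apply/funext => x; rewrite coefC.
by have := reg0 oW; congr reg; apply/funext => x; rewrite coefC.
Qed.

Lemma polyX_section m (W : set X) : (1 < m)%N -> open W ->
  al_sec (trunc_sheaf X m) W (restr W (fun=> 'X)).
Proof.
move=> m1 oW; split=> [x|k].
  by rewrite restrE; case: ifP => _; rewrite ?size_polyX ?size_poly0.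
have := reg_cst (k == 1%N)%:R oW; congr reg; apply/funext => x.
by rewrite coef_restr !restrE coefX.
Qed.

(** Meant for p = c(t) and q = c(H): a lift sends t to a polynomial with terms in degrees 1 and n
    only. *)
Lemma coefM_ends n (p q : {poly K}) : (2 <= n)%N -> p`_0 = 0 ->
  (forall k, (1 < k < n)%N -> p`_k = 0) ->
  (p * q)`_n = p`_1 * q`_(n.-1) + p`_n * q`_0.
Proof.
case: n => [|[|n]] // _ p0 pk.
rewrite coefM big_ord_recl big_ord_recl big_ord_recr /= p0 mul0r add0r subnn.
rewrite big1 ?add0r ?subn1 // => j _.
by rewrite pk ?mul0r // /bump /= !add1n !ltnS ltn_ord.
Qed.

(* Write F = F_0 + t H. Since c(F_0) = F_0 + D(F_0) t^n and c(t) = l t + h t^n,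
   the only products contributing to the coefficient of t^n in c(t) c(H) are
   l t * (l t)^(n-1) and h t^n * H_0. *)
Lemma lift_normal_form n (l : K) (V : set X) c : (2 <= n)%N -> open V ->
  Gm n.+1 V c ->
  (forall W F x k, open W -> W `<=` V -> al_sec (trunc_sheaf X n.+1) W F ->
    (k < n)%N -> (c W F x)`_k = l ^+ k * (F x)`_k) ->
  exists h D, [/\ reg V h, derivation V D
    & forall W F x, open W -> W `<=` V -> al_sec (trunc_sheaf X n.+1) W F ->
      (c W F x)`_n = l ^+ n * (F x)`_n + D W (fun y => (F y)`_0) x
                     + h x * (F x)`_1].
Proof.
move=> n2 oV [cP _] cl.
have n0 : (0 < n)%N by exact: ltnW.
have secC W f : open W -> reg W f ->
    al_sec (trunc_sheaf X n.+1) W (fun x => (f x)%:P).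
  by move=> oW Wf; exact: polyC_section.
have secX W : open W -> al_sec (trunc_sheaf X n.+1) W (restr W (fun=> 'X)).
  by move=> oW; apply: polyX_section.
have secc W F : open W -> W `<=` V -> al_sec (trunc_sheaf X n.+1) W F ->
    al_sec (trunc_sheaf X n.+1) W (c W F).
  by move=> oW WV FW; have [[/(_ _ FW)]] := cP W oW WV.
have c0 W F x : open W -> W `<=` V -> al_sec (trunc_sheaf X n.+1) W F ->
    (c W F x)`_0 = (F x)`_0.
  by move=> oW WV FW; rewrite (cl W F x 0%N) // mul1r.
pose h x := (c V (restr V (fun=> 'X)) x)`_n.
(* D(f) is the coefficient of t^n in c(f), set to zero on the inputs where [derivation] prescribes
   the junk value. *)
pose D W f x :=
  if `[< [/\ open W, W `<=` V & reg W f] >] then (c W (fun y => (f y)%:P) x)`_n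
  else 0.
have DE W f : open W -> W `<=` V -> reg W f ->
    D W f = (fun x => (c W (fun y => (f y)%:P) x)`_n).
  by move=> oW WV Wf; apply/funext => x; rewrite /D asboolT.
exists h, D; split.
- exact: (secc V _ oV (fun x => id) (secX V oV)).2.
- split=> [W f nW|W oW WV].
    by apply/funext => x; rewrite /D asboolF.
  have [_ cD cM _ cR] := cP W oW WV; split.
  + by move=> f Wf; rewrite DE //; apply: (secc W _ oW WV (secC W f oW Wf)).2.
  + move=> a f g Wf Wg; rewrite !DE //; last exact: reg_lin.
    have fW := secC W f oW Wf; have gW := secC W g oW Wg.
    apply/funext => x; rewrite -coefZ -coefD.
    have := congr1 (fun G : X -> {poly K} => (G x)`_n) (cD a _ _ fW gW).
    rewrite /= => <-; congr ((c W _ x)`_n); apply/funext => y.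
    rewrite polyCD polyCM mul_polyC //.
  + move=> f g Wf Wg; rewrite !DE //; last exact: reg_mul.
    have fW := secC W f oW Wf; have gW := secC W g oW Wg.
    apply/funext => x.
    have := congr1 (fun G : X -> {poly K} => (G x)`_n) (cM _ _ fW gW).
    (* Leibniz rule: c(f) and c(g) have no terms in degrees strictly between 0 and n, so only the
       two extreme products contribute to t^n, giving f D(g) + D(f) g. *)
    rewrite /= coef_take_poly ltnSn coefM.
    have -> : (fun y => take_poly n.+1 ((f y)%:P * (g y)%:P)) =
        (fun y => (f y * g y)%:P).
      apply/funext => y; rewrite -polyCM take_poly_id // size_polyC.
      by case: eqP.
    move=> ->; case: n n2 n0 {cP cD cM cR secX h D DE} secC secc c0 cl fW gW.
      by [].
    move=> n n2 n0 secC secc c0 cl fW gW.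
    rewrite big_ord_recl big_ord_recr /= subn0 subnn !c0 // !coefC /=.
    rewrite big1 ?add0r => [|j _]; first by rewrite [_ * g x]mulrC.
    have jn : (bump 0 j < n.+1)%N by rewrite /bump /= add1n ltnS.
    by rewrite cl //= coefC /= mulr0 mul0r.
  + move=> W' f oW' W'W Wf; have W'V := subset_trans W'W WV.
    rewrite !DE //; last exact: reg_restr Wf.
    have := cR W' _ oW' W'W (secC W f oW Wf) => /= e.
    apply/funext => x; rewrite -coef_restr -e; congr ((c W' _ x)`_n).
    by apply/funext => y; rewrite !restrE; case: ifP; rewrite ?polyC0.
- move=> W F x oW WV FW; have [_ cD cM _ _] := cP W oW WV.
  have [_ _ _ _ cR] := cP V oV (fun x => id).
  have F0W := secC W _ oW (FW.2 0%N).
  have HW : al_sec (trunc_sheaf X n.+1) W (fun y => drop_poly 1 (F y)).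
    split=> [y|k].
      by rewrite size_drop_poly (leq_trans (leq_subr _ _)) //; case: FW.
    by have := FW.2 (k + 1)%N; congr reg; apply/funext => y; rewrite coef_drop_poly.
  have tHW : al_sec (trunc_sheaf X n.+1) W
      (al_mul (trunc_sheaf X n.+1) (restr W (fun=> 'X))
        (fun y => drop_poly 1 (F y))).
    split=> [y|k]; first exact: size_take_poly.
    case: k => [|k].
      have := reg0 oW; congr reg; apply/funext => y.
      by rewrite /= coef_take_poly restrE; case: ifP => _;
        rewrite ?mul0r ?coef0 // coefXM.
    have := FW.2 k.+1; congr reg; apply/funext => y.
    have [Wy|Wy] := pselect (W y); last first.
      rewrite /= restrN // mul0r coef_take_poly coef0 (trunc_supp FW Wy) coef0.
      by rewrite if_same.
    rewrite /= restrT // coef_take_poly coefXM /= coef_drop_poly addn1.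
    by case: ltnP => // nk; rewrite (trunc_lt _ FW nk).
  have [Wx|Wx] := pselect (W x); last first.
    rewrite DE //; last exact: (FW.2 0%N).
    rewrite (trunc_supp (secc W F oW WV FW) Wx) (trunc_supp FW Wx).
    by rewrite (trunc_supp (secc W _ oW WV F0W) Wx) !coef0 !mulr0 !addr0.
  (* The splitting F = F_0 + t H; the scalar 1 brings it to the shape of the linearity clause for
     c. *)
  have FE : F = (1 : K) *: (fun y => ((F y)`_0)%:P) +
      al_mul (trunc_sheaf X n.+1) (restr W (fun=> 'X))
        (fun y => drop_poly 1 (F y)).
    rewrite scale1r; apply/funext => y.
    rewrite [RHS](_ : _ = ((F y)`_0)%:P +
      take_poly n.+1 (restr W (fun=> 'X) y * drop_poly 1 (F y))) //.
    have [Wy|Wy] := pselect (W y); last first.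
      by rewrite (trunc_supp FW Wy) coef0 restrN // mul0r take_poly0r addr0.
    apply/polyP => k; rewrite restrT // coefD coefC coef_take_poly coefXM.
    case: k => [|k] /=; first by rewrite addr0.
    rewrite add0r coef_drop_poly addn1.
    by case: ltnP => // nk; rewrite (trunc_lt _ FW nk).
  rewrite {1}FE cD // scale1r.
  rewrite [LHS](_ : _ = (c W (fun y => ((F y)`_0)%:P) x +
    c W (al_mul (trunc_sheaf X n.+1) (restr W (fun=> 'X))
        (fun y => drop_poly 1 (F y))) x)`_n) //.
  rewrite coefD cM //; last exact: secX.
  rewrite DE //; last exact: (FW.2 0%N).
  rewrite /= coef_take_poly ltnSn.
  set cH := c W (fun y => drop_poly 1 (F y)).
  set ct := c W (restr W (fun=> 'X)).
  have ctk k : (k < n)%N -> (ct x)`_k = l ^+ k * (k == 1%N)%:R.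
    by move=> kn; rewrite cl // ?restrT ?coefX //; exact: secX.
  (* The function h was computed over V; compatibility of c with restriction gives its value over
     W. *)
  have ctn : (ct x)`_n = h x.
    have := cR W _ oW WV (secX V oV); rewrite /= => e.
    rewrite /h -(restrT (c V _) Wx) -e /ct; congr ((c W _ x)`_n).
    apply/funext => y; rewrite restrI.
    by rewrite setIC; congr (restr _ _ y); apply/esym/setIidl.
  have cHk k : (k < n)%N -> (cH x)`_k = l ^+ k * (F x)`_k.+1.
    by move=> kn; rewrite cl // coef_drop_poly addn1.
  have ct0 : (ct x)`_0 = 0 by rewrite ctk // mulr0.
  have ct1 k : (1 < k < n)%N -> (ct x)`_k = 0.
    by case/andP=> k1 kn; rewrite ctk // gtn_eqF // mulr0.
  have n1n : (n.-1 < n)%N by rewrite ltn_predL.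
  rewrite (coefM_ends _ n2 ct0 ct1) ctn ctk // !cHk // prednK // mulr1 mul1r.
  by rewrite mulrA -exprD add1n prednK // addrA [_ + l ^+ n * _]addrC.
Qed.

End Lifts.

(** * Representing classes on a common refinement *)

Section Cohomology.
Variables (K : fieldType) (X : topologicalType).
Implicit Types F G H : sheaf K X.

(** The restricted cocycle differs from the original one by the zero cochain on V'. *)
Lemma H1_class_refine F (V V' : Defs.cover X) (r : V' -> V) (z : cocycle F V) :
  (forall a, cset V' a `<=` cset V (r a)) ->
  exists z' : cocycle F V', H1_class z' = H1_class z.
Proof.
move=> rV.
pose y a b := res F (cset V' a `&` cset V' b) (z (r a) (r b)).
have y_sec a b : sec F (cset V' a `&` cset V' b) (y a b).
  apply: sec_resS (cval_sec z (r a) (r b)).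
  - by apply: openI; exact: cset_open.
  - by apply: openI; exact: cset_open.
  - by move=> x [/rV ? /rV].
have y_cond a b c : let Q := cset V' a `&` cset V' b `&` cset V' c in
    res F Q (y a c) = res F Q (y a b) + res F Q (y b c).
  move=> Q; rewrite !res_resS.
  - by apply: cval_condS => x [[/rV ? /rV ?] /rV].
  - by move=> x [[]].
  - by move=> x [[]].
  - by move=> x [[]].
exists (Cocycle y_sec y_cond).
apply/(H1_classP (Tagged (cocycle F) (Cocycle y_sec y_cond))
  (Tagged (cocycle F) z)).
exists V', id, r, (fun=> 0); split=> [w x|||] //.
- by move=> w; apply: sec0; exact: cset_open.
- by move=> v w Q /=; rewrite subrr addr0 res_resS.
Qed.

(** [acts_to] wants both cocycles on one cover refining that of L; the meet of the three covers
    serves. *)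
Lemma H1_common_cover F G (x : H1 F) (y : H1 G) (U : Defs.cover X) :
  exists (V : Defs.cover X) (rho : V -> U) (e : cocycle F V) (d : cocycle G V),
  [/\ forall a, cset V a `<=` cset U (rho a), x = H1_class e & y = H1_class d].
Proof.
have repr_class H (u : H1 H) : exists V (z : cocycle H V), u = H1_class z.
  exists (tag (repr u)), (tagged (repr u)).
  by rewrite -[LHS]reprK /H1_class; case: (repr _).
have [V1 [e ->]] := repr_class F x; have [V2 [d ->]] := repr_class G y.
pose V := cover_meet (cover_meet V1 V2) U.
have [e' e'E] : exists e' : cocycle F V, H1_class e' = H1_class e.
  by apply: (H1_class_refine (r := fun a : V => a.1.1)) => a t [[]].
have [d' d'E] : exists d' : cocycle G V, H1_class d' = H1_class d.
  by apply: (H1_class_refine (r := fun a : V => a.1.2)) => a t [[]].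
by exists V, (fun a => a.2), e', d'; split=> // a t [].
Qed.

End Cohomology.

(** * Coboundaries in M (x) L^k, computed in one trivialization *)

Section Twists.
Variables (K : fieldType) (X : fspace K) (L : line_bundle X).
Let U := cset (lb_cover L).

(* [omodule] does not contain the module axioms, nor the fact that a section
   over V vanishes outside V. *)
Definition faithful_omodule (M : omodule X) :=
  [/\ forall V s, sec M V s -> res M V s = s,
      forall h h' (s : amb M), smul h (smul h' s) = smul (fun x => h x * h' x) s,
      forall s : amb M, smul (fun=> 1) s = s
    & forall V h h' s, sec M V s -> (forall x, V x -> h x = h' x) ->
        smul h s = smul h' s].

Lemma structure_sheaf_faithful : faithful_omodule (structure_sheaf X).
Proof.
split=> [V s|h h' s|s|V h h' s sV hh].
- exact: restr_reg.
- by apply/funext => x; exact: mulrA.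
- by apply/funext => x; exact: mul1r.
- apply/funext => x; rewrite /=; have [Vx|Vx] := pselect (V x).
    by rewrite hh.
  by rewrite (reg_supp sV Vx) !mulr0.
Qed.

Lemma tangent_sheaf_faithful : faithful_omodule (tangent_sheaf X).
Proof.
split=> [V D|h h' D|D|V h h' D].
- move=> [D0 _]; apply/funext => W; apply/funext => f.
  rewrite /= /res_derivation; case: asboolP => // WV.
  by rewrite D0 // => -[_ /WV].
- by apply/funext => W; apply/funext => f; apply/funext => x; exact: mulrA.
- by apply/funext => W; apply/funext => f; apply/funext => x; exact: mul1r.
- move=> [D0 DP] hh; apply/funext => W; apply/funext => f; apply/funext => x /=.
  have [[oW WV Wf]|nW] := pselect [/\ open W, W `<=` V & reg W f]; last first.
    by rewrite D0 // !mulr0.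
  have [D1 _ _ _] := DP W oW WV.
  have [Wx|Wx] := pselect (W x); first by rewrite hh //; exact: WV.
  by rewrite (reg_supp (D1 f Wf) Wx) !mulr0.
Qed.

(** Inside U_j the expression s_j determines all others through s_i = nu_ij^k s_j. *)
Lemma tensor_pow_section_eq M k (V : set X) j s t : faithful_omodule M ->
  V `<=` U j -> sec (tensor_pow M L k) V s -> sec (tensor_pow M L k) V t ->
  s j = t j -> s = t.
Proof.
move=> [M1 _ _ _] VU [s1 s2] [t1 t2] e; apply/funext => i.
rewrite -[LHS](M1 _ _ (s1 i)) -[RHS](M1 _ _ (t1 i)).
have VE : V `&` U i = V `&` (U i `&` U j).
  by rewrite setIA; apply/esym/setIidl => x [/VU].
by rewrite VE s2 t2 e.
Qed.

(** Take s_i = nu_ij^k b on V /\ U_i; agreement on overlaps is the cocycle relation for nu. *)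
Lemma tensor_pow_extend M k (V : set X) j b : faithful_omodule M -> open V ->
  V `<=` U j -> sec M V b ->
  exists s, sec (tensor_pow M L k) V s /\
    forall i Q, open Q -> Q `<=` V -> Q `<=` U i ->
      res M Q (s i) = smul (fun x => lb_nu i j x ^+ k) (res M Q b).
Proof.
move=> [M1 M2 M3 M4] oV VU Vb.
have oU i : open (U i) by exact: cset_open.
pose s i := smul (fun x => restr (V `&` U i) (lb_nu i j : X -> K) x ^+ k)
              (res M (V `&` U i) b).
have oVU i : open (V `&` U i) by exact: openI.
have VUj i : V `&` U i `<=` U i `&` U j by move=> x [/VU].
have sE i Q : open Q -> Q `<=` V -> Q `<=` U i ->
    res M Q (s i) = smul (fun x => lb_nu i j x ^+ k) (res M Q b).
  move=> oQ QV QU; rewrite res_smul res_resS => [|x Qx]; last first.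
    by split; [exact: QV|exact: QU].
  apply: (M4 Q); first exact: sec_resS Vb.
  by move=> x Qx; rewrite restrT //; split; [exact: QV|exact: QU].
exists s; split; last exact: sE; split=> [i|i i' Q].
  (* Induction on k: the zeroth power is the constant 1, which is not extended by zero and so need
     not lie in [reg]; it acts as the identity instead. *)
  rewrite /s; elim: k {sE s} => [|k IH].
    by rewrite M3; apply: sec_resS Vb => // x [].
  rewrite (_ : smul _ _ = smul (restr (V `&` U i) (lb_nu i j : X -> K))
    (smul (fun x => restr (V `&` U i) (lb_nu i j : X -> K) x ^+ k)
      (res M (V `&` U i) b))); last first.
    by rewrite M2; congr smul; apply/funext => x; rewrite exprS.
  apply: sec_smul => //.
  by apply: (@reg_restr _ _ (U i `&` U j)) => //; [exact: openI|exact: lb_reg].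
have oQ : open Q by apply: openI => //; exact: openI.
have QV : Q `<=` V by move=> x [].
have QUi : Q `<=` U i by move=> x [_ []].
have QUi' : Q `<=` U i' by move=> x [_ []].
rewrite !sE //.
rewrite M2; apply: (M4 Q); first by apply: sec_resS Vb => // x [].
by move=> x [Vx [Ux U'x]]; rewrite -exprMn lb_cocycle //; exact: VU.
Qed.

(** Each b_a, read in the trivialization over U_(rho a), extends to a section of M (x) L^k. These
    sections form a cochain with coboundary z - z'; the power of nu moves b_c into the
    trivialization of b_a. *)
Lemma H1_class_eq_twisted M k (V : Defs.cover X) (rho : V -> lb_cover L)
    (z z' : cocycle (tensor_pow M L k) V) (b : V -> amb M) :
  faithful_omodule M -> (forall a, cset V a `<=` U (rho a)) ->
  (forall a, sec M (cset V a) (b a)) ->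
  (forall a c, let Q := cset V a `&` cset V c in
    z a c (rho a) +
      smul (fun x => lb_nu (rho a) (rho c) x ^+ k) (res M Q (b c)) =
    z' a c (rho a) + res M Q (b a)) ->
  H1_class z = H1_class z'.
Proof.
move=> MF rhoU bV zz'; have [M1 M2 M3 M4] := MF.
have oV a : open (cset V a) by exact: cset_open.
have /choice [s sP] a :=
  tensor_pow_extend k MF (oV a) (@rhoU a) (bV a).
apply/(H1_classP (Tagged (cocycle _) z) (Tagged (cocycle _) z')).
exists V, id, id, s; split=> [a x|a x|a|v w Q /=] //; first exact: (sP a).1.
have oQ : open Q by exact: openI.
have Qv : Q `<=` cset V v by move=> x [].
have Qw : Q `<=` cset V w by move=> x [].
have QU : Q `<=` U (rho v) by move=> x /Qv /rhoU.
have secQ (y : cocycle (tensor_pow M L k) V) :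
    sec (tensor_pow M L k) Q (res (tensor_pow M L k) Q (y v w)).
  by apply: sec_resS (cval_sec y v w).
have resQ (y : cocycle (tensor_pow M L k) V) :
    res M Q (y v w (rho v)) = y v w (rho v).
  have [y1 _] := cval_sec y v w.
  by apply: M1; have := y1 (rho v); rewrite /= (setIidl QU).
have secs u : Q `<=` cset V u ->
    sec (tensor_pow M L k) Q (res (tensor_pow M L k) Q (s u)).
  by move=> Qu; apply: sec_resS (sP u).1.
(* The cocycle identity need only be checked in the trivialization over U_(rho v), where it is the
   hypothesis. *)
apply: (tensor_pow_section_eq (j := rho v) MF QU (secQ z)).
  apply: secD => //; first exact: secQ.
  rewrite -scaleN1r addrC; apply: sec_lin => //; first exact: secs.
  exact: secs.
transitivity (res M Q (z' v w (rho v)) +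
  (res M Q (s v (rho v)) - res M Q (s w (rho v)))) => //=.
rewrite !resQ (sP v).2 // (sP w).2 //.
have -> : smul (fun x => lb_nu (rho v) (rho v) x ^+ k) (res M Q (b v)) =
    res M Q (b v).
  rewrite -[RHS]M3; apply: (M4 Q); first exact: sec_resS (bV v).
  by move=> x /QU Ux; rewrite lb_refl // expr1n.
by rewrite addrA -zz' addrK.
Qed.

End Twists.

(** * The action of a scalar: existence and uniqueness of the resulting class *)

Section Action.
Variables (K : fieldType) (X : fspace K) (L : line_bundle X).
Let U := cset (lb_cover L).

(** Clears the inverses in theta: substitute g(c(F)) for F, which loses nothing because g and c are
    bijective on sections over W. *)
Lemma Gm_conj m (V V' W : set X) (c g : local_map X)
    (P Q : (X -> {poly K}) -> X -> {poly K}) :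
  Gm m V c -> Gm m V' g -> open W -> W `<=` V -> W `<=` V' ->
  (forall F, al_sec (trunc_sheaf X m) W F ->
     (P \o Gm_inv m c W \o Gm_inv m g W) F = Q F) <->
  (forall F, al_sec (trunc_sheaf X m) W F -> P F = Q (g W (c W F))).
Proof.
move=> [/(_ W) cP _] [/(_ W) gP _] oW WV WV'.
have [[cf ci cs] _ _ _ _] := cP oW WV; have [[gf gi gs] _ _ _ _] := gP oW WV'.
have invK F : al_sec (trunc_sheaf X m) W F ->
    Gm_inv m c W (Gm_inv m g W (g W (c W F))) = F.
  move=> FW; rewrite /Gm_inv (pinvKV _ gi) ?(pinvKV _ ci) ?inE //.
  exact: cf FW.
split=> PQ F FW; first by rewrite -(PQ _ (gf _ (cf _ FW))) /= invK.
have [G GW <-] := gs F FW; have [H HW <-] := cs G GW.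
by rewrite /= invK // PQ.
Qed.

Lemma gamma_section n (V W : set X) e d F : (2 <= n)%N -> open V -> open W ->
  W `<=` V -> reg V e -> derivation V d -> al_sec (trunc_sheaf X n.+1) W F ->
  al_sec (trunc_sheaf X n.+1) W (gamma n e d W F).
Proof.
move=> n2 oV oW WV eV [_ /(_ W oW WV) [d1 _ _ _]] FW.
split=> [x|k]; first by rewrite /gamma /tmap size_take_poly.
have [kn|nk] := leqP k n; last first.
  have := reg0 oW; congr reg; apply/funext => x.
  by rewrite coef_gamma // leqNgt nk.
have [kE|/negbTE k_n] := eqVneq k n; last first.
  have := FW.2 k; congr reg; apply/funext => x.
  by rewrite coef_gamma // kn k_n addr0.
have eF : reg W (fun x => e x * (F x)`_1).
  have := reg_mul oW (reg_restr oV oW WV eV) (FW.2 1%N).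
  congr reg; apply/funext => x; have [Wx|Wx] := pselect (W x).
    by rewrite restrT.
  by rewrite (trunc_supp FW Wx) coef0 !mulr0.
have := reg_add oW (FW.2 k) (reg_add oW (d1 _ (FW.2 0%N)) eF).
congr reg; apply/funext => x.
by rewrite coef_gamma // kn kE eqxx.
Qed.

Lemma lb_nuK i j x : U i x -> U j x -> lb_nu (l := L) i j x * lb_nu j i x = 1.
Proof. by move=> Ux U'x; rewrite lb_cocycle // lb_refl. Qed.

Lemma tscale_nu_Gm m i j (Q : set X) : open Q -> Q `<=` U i -> Q `<=` U j ->
  Gm m Q (tscale m (lb_nu (l := L) i j)).
Proof.
move=> oQ QUi QUj.
have oU a : open (U a) by exact: cset_open.
apply: (tscale_Gm m (c' := lb_nu j i)) => //.
- apply: (@reg_restr _ _ (U i `&` U j)) => //.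
  + exact: openI.
  + by move=> x Qx; split; [exact: QUi|exact: QUj].
  + exact: lb_reg.
- apply: (@reg_restr _ _ (U j `&` U i)) => //.
  + exact: openI.
  + by move=> x Qx; split; [exact: QUj|exact: QUi].
  + exact: lb_reg.
- by move=> x Qx; apply: lb_nuK; [exact: QUi|exact: QUj].
Qed.

(** In degree n the outer scaling multiplies both d(F_0) and e F_1 by l^n, while the inner one
    multiplies F_0 by 1 and F_1 by l; hence the weights l^n and l^(n-1). *)
Lemma gamma_scale n (l : K) nu e d e' d' W (F : X -> {poly K}) : (2 <= n)%N ->
  (forall x, e' x = l ^+ n.-1 * e x) ->
  (forall V f x, d' V f x = l ^+ n * d V f x) ->
  tscale n.+1 (fun=> l) W (gamma n e d W (tscale n.+1 nu W F)) =
  gamma n e' d' W (tscale n.+1 nu W (tscale n.+1 (fun=> l) W F)).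
Proof.
move=> n2 eE dE; apply/funext => x; apply/polyP => k.
rewrite coef_tscale !coef_gamma // eE dE !coef_tscale !ltnS (ltnW n2).
case: ifP => // ->.
have -> :
    (fun y => (tscale n.+1 nu W (tscale n.+1 (fun=> l) W F) y)`_0) =
    (fun y => (tscale n.+1 nu W F y)`_0).
  by apply/funext => y; rewrite !coef_tscale !mulr1.
case: eqP => [->|_]; last by rewrite !addr0 mulrAC.
by case: n n2 {eE dE} => [|n'] // _; rewrite /= !expr1 !exprS; ring.
Qed.

Lemma tensor_pow_scaleE M k (V : Defs.cover X)
    (z : cocycle (tensor_pow M L k) V) c a b i :
  cocycle_scale c z a b i = c *: z a b i.
Proof. by []. Qed.

Lemma structure_scaleE k (V : Defs.cover X)
    (z : cocycle (tensor_pow (structure_sheaf X) L k) V) c a b i x :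
  cocycle_scale c z a b i x = c * z a b i x.
Proof. by rewrite tensor_pow_scaleE. Qed.

Lemma tangent_scaleE k (V : Defs.cover X)
    (z : cocycle (tensor_pow (tangent_sheaf X) L k) V) c a b i W f x :
  cocycle_scale c z a b i W f x = c * z a b i W f x.
Proof. by rewrite tensor_pow_scaleE. Qed.

(** The lifts c_a : t |-> l t commute with the gluing maps, so theta is [gamma] of the rescaled
    cocycles themselves. *)
Lemma scalar_acts_to n (l : K) (l0 : l != 0) eta eps : (2 <= n)%N ->
  acts_to (scalar_aut L n l0) (eta, eps)
    (H1_scale (l ^+ n.-1) eta, H1_scale (l ^+ n) eps).
Proof.
move=> n2.
have [V [rho [e [d [VU -> ->]]]]] := H1_common_cover eta eps (lb_cover L).
exists V, rho, e, (cocycle_scale (l ^+ n.-1) e), d, (cocycle_scale (l ^+ n) d).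
exists (fun=> tscale n (fun=> l)), (fun=> tscale n.+1 (fun=> l)).
have oV a : open (cset V a) by exact: cset_open.
have scaleGm m a : Gm m (cset V a) (tscale m (fun=> l)).
  apply: (tscale_Gm m (c' := fun=> l^-1)) => //; try exact: reg_cst.
  by move=> x _; rewrite divff.
split=> //.
- by rewrite !H1_scaleE.
- move=> a; split=> //.
  move=> W F oW WV FW; apply/funext => x; apply/polyP => k.
  rewrite coef_take_poly !coef_tscale coef_take_poly; case: ltnP => // kn.
  by rewrite ltnS ltnW.
- move=> a b W F oW WQ FW g; move: F FW.
  have WVb : W `<=` cset V b by move=> x /WQ[].
  have WVa : W `<=` cset V a by move=> x /WQ[].
  have gGm : Gm n.+1 W g.
    by apply: tscale_nu_Gm => // x; [move=> /WVa /VU|move=> /WVb /VU].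
  apply/(Gm_conj (tscale n.+1 (fun=> l) W \o
    gamma n (e a b (rho a)) (d a b (rho a)) W \o g W) _
    (scaleGm n.+1 b) gGm oW WVb) => // F FW.
  have eE x : cocycle_scale (l ^+ n.-1) e a b (rho a) x =
      l ^+ n.-1 * e a b (rho a) x.
    exact: structure_scaleE.
  have dE W' f x : cocycle_scale (l ^+ n) d a b (rho a) W' f x =
      l ^+ n * d a b (rho a) W' f x.
    exact: tangent_scaleE.
  exact: (gamma_scale _ _ _ n2 eE dE).
Qed.

(** The coefficient of t^n in c_a gamma g (G) = gamma' g c_b (G), after cancelling the common term
    l^n nu^n G_n. *)
Lemma gamma_conj_eq n (l : K) (nu : X -> K) (W : set X) (ca cb : local_map X)
    ha hb Da Db e e' d d' G x :
  (2 <= n)%N -> nu x != 0 -> l != 0 ->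
  (forall F, al_sec (trunc_sheaf X n.+1) W F -> (ca W F x)`_n =
     l ^+ n * (F x)`_n + Da W (fun y => (F y)`_0) x + ha x * (F x)`_1) ->
  (forall F, al_sec (trunc_sheaf X n.+1) W F -> (cb W F x)`_n =
     l ^+ n * (F x)`_n + Db W (fun y => (F y)`_0) x + hb x * (F x)`_1) ->
  (forall F y k, al_sec (trunc_sheaf X n.+1) W F -> (k < n)%N ->
     (cb W F y)`_k = l ^+ k * (F y)`_k) ->
  al_sec (trunc_sheaf X n.+1) W G ->
  al_sec (trunc_sheaf X n.+1) W (gamma n e d W (tscale n.+1 nu W G)) ->
  ca W (gamma n e d W (tscale n.+1 nu W G)) =
    gamma n e' d' W (tscale n.+1 nu W (cb W G)) ->
  let f y := (G y)`_0 in
  l ^+ n * (d W f x + e x * nu x * (G x)`_1) + Da W f x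
    + ha x * nu x * (G x)`_1 =
  nu x ^+ n * (Db W f x + hb x * (G x)`_1) + d' W f x
    + e' x * nu x * l * (G x)`_1.
Proof.
move=> n2 nu0 l0 caE cbE cbk GW gW E f.
have := congr1 (fun H : X -> {poly K} => (H x)`_n) E.
have n0 : (0 < n)%N by exact: ltnW.
rewrite /= caE //.
have -> : (fun y => (gamma n e d W (tscale n.+1 nu W G) y)`_0) = f.
  apply/funext => y.
  by rewrite coef_gamma // ltn_eqF //= addr0 coef_tscale mulr1.
rewrite !coef_gamma // leqnn eqxx n0 ltn_eqF // addr0.
have -> : (fun y => (tscale n.+1 nu W (cb W G) y)`_0) = f.
  by apply/funext => y; rewrite coef_tscale mulr1 cbk // mul1r.
have -> : (fun y => (tscale n.+1 nu W G y)`_0) = f.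
  by apply/funext => y; rewrite coef_tscale mulr1.
rewrite !coef_tscale ltnSn ltnS n0 cbE // cbk // -/f !expr1 => E1.
apply: (addrI (l ^+ n * (G x)`_n * nu x ^+ n)).
transitivity (l ^+ n * ((G x)`_n * nu x ^+ n + (d W f x + e x * ((G x)`_1 * nu x))) +
  Da W f x + ha x * ((G x)`_1 * nu x)); first by ring.
by rewrite E1; ring.
Qed.

(** Subtract the first equation (G = 0) from the second (G = t), then divide by l nu. *)
Lemma coboundary_of_conj n (l nu ha hb Da Db e e' d d' : K) : (2 <= n)%N ->
  nu != 0 -> l != 0 ->
  l ^+ n * d + Da = nu ^+ n * Db + d' ->
  l ^+ n * (d + e * nu * 1) + Da + ha * nu * 1 =
    nu ^+ n * (Db + hb * 1) + d' + e' * nu * l * 1 ->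
  l ^+ n.-1 * e + l^-1 * ha = e' + nu ^+ n.-1 * (l^-1 * hb).
Proof.
case: n => // m _ nu0 l0 E0 E1; rewrite /=.
have E2 : l ^+ m.+1 * e * nu + ha * nu = nu ^+ m.+1 * hb + e' * nu * l.
  apply: (addrI (l ^+ m.+1 * d + Da)); rewrite {2}E0.
  by transitivity (l ^+ m.+1 * (d + e * nu * 1) + Da + ha * nu * 1);
    [|rewrite E1]; ring.
apply: (mulIf (mulf_neq0 nu0 l0)).
have lV : l * l^-1 = 1 by rewrite divff.
transitivity (l ^+ m.+1 * e * nu + (l * l^-1) * (ha * nu)).
  by rewrite exprS; ring.
rewrite lV mul1r E2.
transitivity ((l * l^-1) * (nu ^+ m.+1 * hb) + e' * nu * l).
  by rewrite lV mul1r.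
by rewrite exprS; ring.
Qed.

Lemma scalar_acts_to_unique n (l : K) (l0 : l != 0) eta eps y : (2 <= n)%N ->
  acts_to (scalar_aut L n l0) (eta, eps) y ->
  y = (H1_scale (l ^+ n.-1) eta, H1_scale (l ^+ n) eps).
Proof.
move=> n2 [V [rho [e [e' [d [d' [chi_ [c [VU [-> ->] -> cP E]]]]]]]]].
have n0 : (0 < n)%N by exact: ltnW.
have oV a : open (cset V a) by exact: cset_open.
have cl a : forall W F x k, open W -> W `<=` cset V a ->
    al_sec (trunc_sheaf X n.+1) W F -> (k < n)%N ->
    (c a W F x)`_k = l ^+ k * (F x)`_k.
  by have [cchi _ clift] := cP a; exact: scalar_lift_coef (@VU a) cchi clift.
have /choice [h /choice [D hDP]] a :
    exists h D, [/\ reg (cset V a) h, derivation (cset V a) D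
      & forall W F x, open W -> W `<=` cset V a ->
        al_sec (trunc_sheaf X n.+1) W F -> (c a W F x)`_n =
        l ^+ n * (F x)`_n + D W (fun y => (F y)`_0) x + h x * (F x)`_1].
  by have [_ cGm _] := cP a; exact: lift_normal_form n2 (oV a) cGm (cl a).
have secE (M : omodule X) k (z : cocycle (tensor_pow M L k) V) a b :
    sec M (cset V a `&` cset V b) (z a b (rho a)).
  have [/(_ (rho a)) z1 _] := cval_sec z a b; move: z1.
  by rewrite (setIidl (B := cset _ _)) // => x [/VU].
have key a b W G x : open W -> W `<=` cset V a `&` cset V b -> W x ->
    al_sec (trunc_sheaf X n.+1) W G ->
    let nu := lb_nu (l := L) (rho a) (rho b) in let f y := (G y)`_0 in
    l ^+ n * (d a b (rho a) W f x + e a b (rho a) x * nu x * (G x)`_1) +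
      D a W f x + h a x * nu x * (G x)`_1 =
    nu x ^+ n * (D b W f x + h b x * (G x)`_1) + d' a b (rho a) W f x
      + e' a b (rho a) x * nu x * l * (G x)`_1.
  move=> oW WQ Wx GW nu f.
  have WVb : W `<=` cset V b by move=> t /WQ[].
  have WVa : W `<=` cset V a by move=> t /WQ[].
  have WUa : W `<=` U (rho a) by move=> t /WVa /VU.
  have WUb : W `<=` U (rho b) by move=> t /WVb /VU.
  have nu0 : nu x != 0.
    apply: contraTneq (oner_neq0 K) => nux.
    by rewrite -(lb_nuK (WUa x Wx) (WUb x Wx)) -/nu nux mul0r eqxx.
  have gGm : Gm n.+1 W (tscale n.+1 nu) by exact: tscale_nu_Gm.
  have [_ bGm _] := cP b.
  have [_ _ caE] := hDP a; have [_ _ cbE] := hDP b.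
  apply: (gamma_conj_eq (ca := c a) (cb := c b)) => //.
  - by move=> F FW; apply: caE.
  - by move=> F FW; apply: cbE.
  - by move=> F t k FW; apply: cl.
  - apply: (gamma_section (V := cset V a `&` cset V b)) => //.
    + exact: openI.
    + exact: (secE (structure_sheaf X)).
    + exact: (secE (tangent_sheaf X)).
    + by have [/(_ W oW (fun t => id)) [[gf _ _] _ _ _ _] _] := gGm; exact: gf.
  (* The defining equation of theta with its inverses cleared. *)
  - move: G GW {f}; apply/(Gm_conj (c a W \o
      gamma n (e a b (rho a)) (d a b (rho a)) W \o tscale n.+1 nu W)
      (gamma n (e' a b (rho a)) (d' a b (rho a)) W) bGm gGm oW WVb) => //.
    by move=> F FW; exact: E.
(* Taking G = f constant in t kills the G_1 terms and isolates the vector fields. *)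
have keyT a b W f x : open W -> W `<=` cset V a `&` cset V b -> W x -> reg W f ->
    l ^+ n * d a b (rho a) W f x + D a W f x =
    lb_nu (rho a) (rho b) x ^+ n * D b W f x + d' a b (rho a) W f x.
  move=> oW WQ Wx Wf.
  have := key a b W _ x oW WQ Wx (polyC_section (ltn0Sn n) oW Wf).
  rewrite /= coefC /= !mulr0 !addr0.
  by have -> : (fun t => (f t)%:P`_0) = f by apply/funext => t; rewrite coefC.
have keyO a b x : cset V a x -> cset V b x ->
    l ^+ n.-1 * e a b (rho a) x + l^-1 * h a x =
    e' a b (rho a) x + lb_nu (rho a) (rho b) x ^+ n.-1 * (l^-1 * h b x).
  move=> Vax Vbx; pose Q := cset V a `&` cset V b.
  have oQ : open Q by exact: openI.
  have Qx : Q x by [].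
  have nu0 : lb_nu (l := L) (rho a) (rho b) x != 0.
    apply: contraTneq (oner_neq0 K) => nux.
    by rewrite -(lb_nuK (VU a x Vax) (VU b x Vbx)) nux mul0r eqxx.
  have := key a b Q _ x oQ (fun t => id) Qx
    (polyX_section (ltnW n2 : 1 < n.+1)%N oQ).
  have XE : (fun y : X => (restr Q (fun=> 'X) y : {poly K})`_0) = (fun=> 0).
    by apply/funext => t; rewrite coef_restr restrE coefX /= if_same.
  (* For G = t the derivations are evaluated at the zero function; subtracting [keyT] at f = 0
     removes these values. *)
  have := keyT a b Q _ x oQ (fun t => id) Qx (reg0 oQ).
  rewrite /= XE restrT // coefX /=.
  set nu := lb_nu _ _ x in nu0 *.
  move: (d a b _ _ _ x) (D a _ _ x) (D b _ _ x) (d' a b _ _ _ x).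
  move: (e a b _ x) (h a x) (h b x) (e' a b _ x) => ex hax hbx e'x dx Dax Dbx d'x.
  exact: coboundary_of_conj.
congr pair.
(* The cochain l^-1 h_a relates e' to l^(n-1) e; below, D_a itself relates d' to l^n d. *)
- have hV a : sec (structure_sheaf X) (cset V a) (fun x => l^-1 * h a x).
    by apply: regZ => //; case: (hDP a).
  rewrite H1_scaleE.
  apply: (H1_class_eq_twisted (structure_sheaf_faithful X) VU hV).
  move=> a b Q; apply/funext => x.
  transitivity (e' a b (rho a) x + lb_nu (rho a) (rho b) x ^+ n.-1 *
      restr Q (fun t => l^-1 * h b t) x) => //.
  transitivity (cocycle_scale (l ^+ n.-1) e a b (rho a) x +
      restr Q (fun t => l^-1 * h a t) x) => //.
  rewrite structure_scaleE; have [Qx|Qx] := pselect (Q x); last first.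
    rewrite !restrN // (reg_supp (secE (structure_sheaf X) _ e' a b) Qx).
    by rewrite (reg_supp (secE (structure_sheaf X) _ e a b) Qx) !mulr0.
  by rewrite !restrT // keyO //; case: Qx.
- have DV a : sec (tangent_sheaf X) (cset V a) (D a) by case: (hDP a).
  rewrite H1_scaleE.
  apply: (H1_class_eq_twisted (tangent_sheaf_faithful X) VU DV).
  move=> a b Q; apply/funext => W; apply/funext => f; apply/funext => x.
  transitivity (d' a b (rho a) W f x + lb_nu (rho a) (rho b) x ^+ n *
      res_derivation Q (D b) W f x) => //.
  transitivity (cocycle_scale (l ^+ n) d a b (rho a) W f x +
      res_derivation Q (D a) W f x) => //.
  rewrite tangent_scaleE.
  have [dQ0 dQ] := secE (tangent_sheaf X) _ d a b.
  have [dQ0' dQ'] := secE (tangent_sheaf X) _ d' a b.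
  have [_ [Da0 Da] _] := hDP a; have [_ [Db0 Db] _] := hDP b.
  have QVa : Q `<=` cset V a by move=> t [].
  have QVb : Q `<=` cset V b by move=> t [].
  rewrite /res_derivation.
  (* On junk inputs, and then at points outside W, every term vanishes; only the remaining case uses
     [keyT]. *)
  have [[oW WQ Wf]|nW] := pselect [/\ open W, W `<=` Q & reg W f]; last first.
    rewrite dQ0 // dQ0' // mulr0 !add0r; case: asboolP => [WQ|_]; last first.
      by rewrite mulr0.
    by rewrite Da0 ?Db0 ?mulr0 // => -[oW _ Wf]; apply: nW.
  rewrite asboolT //; have [Wx|Wx] := pselect (W x); last first.
    have [d1 _ _ _] := dQ W oW WQ; have [d'1 _ _ _] := dQ' W oW WQ.
    have [Da1 _ _ _] := Da W oW (subset_trans WQ QVa).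
    have [Db1 _ _ _] := Db W oW (subset_trans WQ QVb).
    rewrite (reg_supp (d1 f Wf) Wx) (reg_supp (d'1 f Wf) Wx).
    by rewrite (reg_supp (Da1 f Wf) Wx) (reg_supp (Db1 f Wf) Wx) !mulr0.
  by rewrite keyT // addrC.
Qed.

End Action.

Unset Implicit Arguments.

Theorem proposition6p6p1 (R : realType) (X : fspace R[i])
    (X_variety : variety X) (X_smooth : smooth X)
    (X_connected : connected [set: X])
    (L : line_bundle X) (n : nat) (n_ge2 : (2 <= n)%N)
    (eta : H1 (tensor_pow (structure_sheaf X) L n.-1))
    (eps : H1 (tensor_pow (tangent_sheaf X) L n))
    (l : R[i]) (l_neq0 : l != 0) :
  Aut_act (scalar_aut L n l_neq0) (eta, eps) =
  (H1_scale (l ^+ n.-1) eta, H1_scale (l ^+ n) eps).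
Proof.
(* [Aut_act] picks some class related to (eta, eps) once one exists; uniqueness identifies it, so
   the default value of [xget] is never reached. *)
apply: (scalar_acts_to_unique n_ge2); apply: (xgetPex (eta, eps)).
exists (H1_scale (l ^+ n.-1) eta, H1_scale (l ^+ n) eps).
exact: scalar_acts_to.
Qed.
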